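(* Let $(M,g)$ be a compact Riemannian manifold without boundary, let $\mu$ be a real constant, and let $(u,p)$ be a (time-dependent) vector field and function on $M$ solving the Navier–Stokes system \[ u_t+\nabla_u u-\mu\, Lu+\mathsf{grad}(p)=0,\qquad \mathsf{div}(u)=0 . \] Let $v$ be a (time-independent) Killing vector field on $M$. Then \[ \frac{d}{dt}\langle u,v\rangle=0 . \]
   Context: All fields are smooth. $\nabla$ is the Levi-Civita connection, $\nabla_u u$ has components $u^k_{;i}u^i$, $\mathsf{grad}(p)=g^{ij}p_{;j}$, $\mathsf{div}(u)=u^i_{;i}$. In $u^k_{;ij}$ the rightmost index is the last covariant derivative taken. The diffusion operator is $Lu=\mathsf{div}(Su)$, where $(Su)^{kj}=g^{ki}u^j_{;i}+g^{ij}u^k_{;i}$, i.e. $(Lu)^j=g^{ki}u^j_{;ik}+g^{ij}u^k_{;ik}$. A vector field $v$ is Killing if $Sv=0$, equivalently $g(\nabla_X v,Y)+g(\nabla_Y v,X)=0$ for all vector fields $X,Y$. The inner product is $\langle u,v\rangle=\int_M g(u,v)\,\omega_M$, with $\omega_M$ the Riemannian volume form (or density if $M$ is not orientable). *)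

(* Defs.v *)
From HB Require Import structures.
From mathcomp Require Export all_boot all_order all_algebra.
From mathcomp Require Export all_classical all_reals all_analysis.

Set Implicit Arguments.
Unset Strict Implicit.
Unset Printing Implicit Defensive.
Import Order.TTheory GRing.Theory Num.Theory numFieldNormedType.Exports.

Local Open Scope classical_set_scope.
Local Open Scope ring_scope.

Section calculus.
Variable R : realType.

(* [iter_derive [:: v1; ...; vr] f = D_v1 (D_v2 (... (D_vr f)))]. *)
Definition iter_derive (V : normedModType R) (s : seq V) (f : V -> R) : V -> R :=
  foldr (fun v h => fun x => 'D_v h x) f s.

(* C^infinity on an open subset [U] of a finite-dimensional space: iterated
   directional derivatives of all orders exist and are continuous on [U].
   Quantifying over all directions rather than over those of a basis lets the
   same definition serve for R^n and for R * R^n. *)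
Definition smooth_on (V : normedModType R) (U : set V) (f : V -> R) : Prop :=
  forall (s : seq V) (x : V), U x ->
    {for x, continuous (iter_derive s f)} /\
    forall v : V, derivable (iter_derive s f) x v.

Definition pd (n : nat) (i : 'I_n) (f : 'rV[R]_n -> R) (x : 'rV[R]_n) : R :=
  'D_(delta_mx 0 i) f x.

(* Lebesgue integral over R^n of a nonnegative Borel function, as an iterated
   integral (Tonelli); for n = 0 it is evaluation at the unique point. *)
Fixpoint lebesgue_int (n : nat) : ('rV[R]_n -> \bar R) -> \bar R :=
  match n return ('rV[R]_n -> \bar R) -> \bar R with
  | 0%N => fun f => f 0
  | n'.+1 => fun f =>
      (\int[@lebesgue_measure R]_t
         lebesgue_int (fun x : 'rV[R]_n' => f (row_mx (t%:M : 'M[R]_1) x)))%E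
  end.

End calculus.

(* A smooth n-dimensional atlas without boundary on [M].  The map [coord c] is
   only meaningful on [cdom c], and its inverse [param c] on [coord c @` cdom c].
   As in a charted space, the atlas comes with a preferred chart around each
   point, which also expresses that the chart domains cover [M]. *)
Record smooth_atlas (R : realType) (n : nat) (M : topologicalType) := SmoothAtlas {
  chart : Type;
  cdom : chart -> set M;
  coord : chart -> M -> 'rV[R]_n;
  param : chart -> 'rV[R]_n -> M;
  chart_at : M -> chart;
  cdom_chart_at : forall m, cdom (chart_at m) m;
  open_cdom : forall c, open (cdom c);
  open_cimg : forall c, open (coord c @` cdom c);
  coordK : forall c m, cdom c m -> param c (coord c m) = m;
  continuous_coord : forall c m, cdom c m -> {for m, continuous (coord c)};
  continuous_param : forall c x, (coord c @` cdom c) x ->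
    {for x, continuous (param c)};
  smooth_transition : forall (c d : chart) (k : 'I_n),
    smooth_on (coord c @` (cdom c `&` cdom d))
              (fun x => coord d (param c x) 0 k)
}.

Section fields.
Variables (R : realType) (n : nat) (M : topologicalType).
Variable A : smooth_atlas R n M.

Definition cimg (c : chart A) : set 'rV[R]_n := coord c @` cdom c.

(* [jac c d k i x] is the derivative of the k-th coordinate of [d] with respect
   to the i-th coordinate of [c]. *)
Definition jac (c d : chart A) (k i : 'I_n) (x : 'rV[R]_n) : R :=
  pd i (fun y => coord d (param c y) 0 k) x.

(* Vector fields are families of components, [X c x 0 k] being X^k at the point
   of coordinates [x] in the chart [c]; only [x] in [cimg c] matters. *)
Definition components : Type := chart A -> 'rV[R]_n -> 'rV[R]_n.

Definition contravariant (X : components) : Prop :=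
  forall (c d : chart A) (m : M), cdom c m -> cdom d m -> forall k : 'I_n,
    X d (coord d m) 0 k
    = \sum_(i < n) jac c d k i (coord c m) * X c (coord c m) 0 i.

Definition smooth_vector_field (X : components) : Prop :=
  contravariant X /\
  forall (c : chart A) (k : 'I_n), smooth_on (cimg c) (fun x => X c x 0 k).

Definition smooth_time_vector_field (J : set R) (u : R -> components) : Prop :=
  (forall t, J t -> contravariant (u t)) /\
  forall (c : chart A) (k : 'I_n),
    smooth_on [set z : R * 'rV[R]_n | J z.1 /\ cimg c z.2]
              (fun z => u z.1 c z.2 0 k).

Definition smooth_time_function (J : set R) (p : R -> M -> R) : Prop :=
  forall c : chart A,
    smooth_on [set z : R * 'rV[R]_n | J z.1 /\ cimg c z.2]
              (fun z => p z.1 (param c z.2)).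

Record riemannian_metric := RiemannianMetric {
  gmx :> chart A -> 'rV[R]_n -> 'M[R]_n;
  metric_smooth : forall (c : chart A) (i j : 'I_n),
    smooth_on (cimg c) (fun x => gmx c x i j);
  metric_sym : forall (c : chart A) x, cimg c x -> (gmx c x)^T = gmx c x;
  metric_pos : forall (c : chart A) x, cimg c x -> forall w : 'rV[R]_n, w != 0 ->
    0 < (w *m gmx c x *m w^T) 0 0;
  metric_covariant : forall (c d : chart A) (m : M), cdom c m -> cdom d m ->
    forall i j : 'I_n,
      gmx c (coord c m) i j
      = \sum_(k < n) \sum_(l < n) jac c d k i (coord c m) *
          jac c d l j (coord c m) * gmx d (coord d m) k l
}.

Variable g : riemannian_metric.

Definition ginv (c : chart A) (x : 'rV[R]_n) : 'M[R]_n := invmx (g c x).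

(* [christoffel c k i j] is Gamma^k_{ij} of the Levi-Civita connection. *)
Definition christoffel (c : chart A) (k i j : 'I_n) (x : 'rV[R]_n) : R :=
  2^-1 * \sum_(l < n) ginv c x k l *
    (pd i (fun y => g c y j l) x + pd j (fun y => g c y i l) x
     - pd l (fun y => g c y i j) x).

(* u^k_{;i} *)
Definition covd (u : components) (c : chart A) (k i : 'I_n) (x : 'rV[R]_n) : R :=
  pd i (fun y => u c y 0 k) x + \sum_(j < n) christoffel c k i j x * u c x 0 j.

Definition div (u : components) (c : chart A) (x : 'rV[R]_n) : R :=
  \sum_(i < n) covd u c i i x.

(* (nabla_u u)^k *)
Definition advection (u : components) (c : chart A) (k : 'I_n) (x : 'rV[R]_n) : R :=
  \sum_(i < n) covd u c k i x * u c x 0 i.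

Definition grad (p : M -> R) (c : chart A) (k : 'I_n) (x : 'rV[R]_n) : R :=
  \sum_(j < n) ginv c x k j * pd j (fun y => p (param c y)) x.

(* (Su)^{kj} *)
Definition strain (u : components) (c : chart A) (k j : 'I_n) (x : 'rV[R]_n) : R :=
  \sum_(i < n) ginv c x k i * covd u c j i x
  + \sum_(i < n) ginv c x i j * covd u c k i x.

(* T^{kj}_{;k}, for a twice contravariant tensor T given by its components in
   the chart [c]. *)
Definition div2 (c : chart A) (T : 'I_n -> 'I_n -> 'rV[R]_n -> R)
    (j : 'I_n) (x : 'rV[R]_n) : R :=
  \sum_(k < n) (pd k (T k j) x
    + \sum_(l < n) christoffel c k k l x * T l j x
    + \sum_(l < n) christoffel c j k l x * T k l x).

(* (Lu)^j *)
Definition diffusion (u : components) (c : chart A) (j : 'I_n) (x : 'rV[R]_n) : R :=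
  div2 c (strain u c) j x.

Definition killing (v : components) : Prop :=
  forall (c : chart A) x, cimg c x -> forall k j : 'I_n, strain v c k j x = 0.

Definition navier_stokes (mu : R) (J : set R) (u : R -> components)
    (p : R -> M -> R) : Prop :=
  forall t, J t -> forall (c : chart A) x, cimg c x ->
    (forall k : 'I_n,
       'D_1 (fun s : R => u s c x 0 k) t + advection (u t) c k x
       - mu * diffusion (u t) c k x + grad (p t) c k x = 0) /\
    div (u t) c x = 0.

(* g(X, Y) as a function on M; by the transformation laws the value does not
   depend on the chart used. *)
Definition gdot (X Y : components) (m : M) : R :=
  let c := chart_at A m in
  let x := coord c m in
  (X c x *m g c x *m (Y c x)^T) 0 0.

End fields.

Notation borel M := (g_sigma_algebraType (@open M)).

Section volume.
Variables (R : realType) (n : nat) (M : ptopologicalType).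
Variables (A : smooth_atlas R n M) (g : riemannian_metric A).

(* The Riemannian volume density, as a Borel measure on M: in every chart it is
   sqrt(det g) times Lebesgue measure.  This determines the measure uniquely on
   a compact M, which needs no orientation. *)
Definition is_riemannian_volume
    (omega : {measure set (borel M) -> \bar R}) : Prop :=
  forall (c : chart A) (B : set (borel M)), measurable B -> B `<=` cdom c ->
    omega B = lebesgue_int (fun x : 'rV[R]_n =>
      (\1_(coord c @` B) x * Num.sqrt (\det (g c x)))%:E).

Definition inner (omega : {measure set (borel M) -> \bar R})
    (X Y : components A) : R :=
  \int[omega]_m gdot g X Y m.

End volume.

(* Main.v *)
(* In a chart set W^k = u^k g(u, v) - mu S^kj v_j + p v^k. Since v_{j;k} is
   antisymmetric for a Killing field while u^j u^k and S^kj are symmetric, and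
   div u = div v = 0, the Navier-Stokes equations give g(u_t, v) = - div W.
   Differentiating under the integral sign, d/dt <u, v> is the integral of
   g(u_t, v), and the divergence theorem shows that it vanishes. The latter is
   reduced by a partition of unity to integrals of partial derivatives of
   compactly supported functions on R^n, which are zero by translation
   invariance of the Lebesgue integral; no change of variables is needed. *)

Require Import Defs.
From HB Require Import structures.
From mathcomp Require Import ring lra measurable_realfun perm.

Set Implicit Arguments.
Unset Strict Implicit.
Unset Printing Implicit Defensive.
Import Order.TTheory GRing.Theory Num.Theory numFieldNormedType.Exports.
Local Open Scope classical_set_scope.
Local Open Scope ring_scope.

(** * Calculus on row vectors *)

Section line_calculus.
Variables (R : realType) (V : normedModType R).
Implicit Types (f : V -> R) (x v : V).

(** The formula of the flux contains Christoffel symbols, which are not tensorial, so proving that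
    the flux is a vector field on M would be laborious. This is avoided: divergences are taken in
    one chart at a time, and between charts only the flux applied to a function chi is compared.
    There S^kj v_j d_k chi = (L_u g)(grad chi, v), and the Lie derivative of the metric obeys a
    transformation law without any connection. Each function of the partition of unity lives in a
    single chart, so its integral is computed in that chart alone, and the summation over the
    partition is a pointwise sum of functions on M; two chart integrals are never compared.
    Coordinate divergences become Riemannian ones through d_k sqrt(det g) = sqrt(det g) Gamma^i_ik,
    a consequence of Jacobi's formula. [smooth_on] provides directional derivatives only, hence the
    calculus built on [C1on], where continuous partial derivatives give differentiability.
    Domination under the integral sign needs finite total volume; the chartwise specification of
    [omega] does not state it, and compactness supplies it. *)

Lemma is_derive_line f x v (s : R) : derivable f (x + s *: v) v ->
  is_derive s 1 (fun r : R => f (x + r *: v)) ('D_v f (x + s *: v)).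
Proof.
have E : (fun h : R => h^-1 *: (((fun r : R => f (x + r *: v)) \o shift s) (h *: 1)
    - f (x + s *: v))) =
  (fun h : R => h^-1 *: ((f \o shift (x + s *: v)) (h *: v) - f (x + s *: v))).
  by apply/funext => h /=; rewrite [h *: 1]mulr1 scalerDl addrCA.
by move=> fv; split; rewrite /derivable /derive E.
Qed.

Lemma MVT_line_ge0 f x v (c : R) : 0 <= c ->
  (forall s, 0 <= s <= c -> derivable f (x + s *: v) v) ->
  exists2 s : R, 0 <= s <= c & f (x + c *: v) - f x = c * 'D_v f (x + s *: v).
Proof.
move=> c0 fv.
have [||s sc] := @MVT_segment _ (fun r : R => f (x + r *: v))
  (fun s => 'D_v f (x + s *: v)) 0 c c0.
- move=> s /[!in_itv]/= /andP[s0 sc]; apply: is_derive_line.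
  by apply: fv; rewrite !ltW.
- apply: derivable_within_continuous => s; rewrite in_itv/= => sc.
  exact: (@ex_derive _ _ _ _ _ _ _ (is_derive_line (fv _ sc))).
by rewrite scale0r addr0 subr0 mulrC => ->; exists s.
Qed.

Lemma MVT_line f x v (c : R) :
  (forall s, `|s| <= `|c| -> derivable f (x + s *: v) v) ->
  exists2 s : R, `|s| <= `|c| & f (x + c *: v) - f x = c * 'D_v f (x + s *: v).
Proof.
move=> fv; have [c0|c0] := leP 0 c.
  have [s /andP[s0 sc]|s /andP[s0 sc] E] := @MVT_line_ge0 f x v c c0.
    by apply: fv; rewrite !ger0_norm.
  by exists s => //; rewrite !ger0_norm.
(* For negative [c] the segment is run from its other end [x + c *: v], with length [- c]. *)
have Nc0 : 0 <= - c by rewrite oppr_ge0 ltW.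
have E s : x + c *: v + s *: v = x + (c + s) *: v by rewrite -addrA scalerDl.
have [s /andP[s0 sc]|s /andP[s0 sc]] := @MVT_line_ge0 f (x + c *: v) v (- c) Nc0.
  rewrite E; apply: fv; rewrite ler0_norm ?(ltr0_norm c0)//; lra.
rewrite !E subrr scale0r addr0 => fE; exists (c + s).
  rewrite ler0_norm ?(ltr0_norm c0)//; lra.
lra.
Qed.

End line_calculus.

(** * Continuously differentiable functions on open sets *)

Section C1.
Variables (R : realType) (n : nat).
Notation V := 'rV[R]_n.
Implicit Types (f : V -> R) (U : set V).

Lemma rV_norm_le (x : V) i : `|x 0 i| <= `|x|.
Proof.
by rewrite [leRHS]/Num.norm /= mx_normrE; apply/bigmax_geP; right => /=; exists (0, i).
Qed.

Lemma rV_norm_leP (x : V) (c : R) : 0 <= c -> (forall i, `|x 0 i| <= c) -> `|x| <= c.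
Proof.
move=> c0 xc; rewrite [leLHS]/Num.norm /= mx_normrE; apply/bigmax_leP; split => //.
by case=> i j _ /=; rewrite ord1.
Qed.

(** The candidate for the differential, bundled as a continuous linear map because uniqueness of the
    differential is stated for such maps. *)
Lemma row_sum_pd (a : 'I_n -> R) : exists df : {linear V -> R},
  continuous df /\ forall h, df h = \sum_i h 0 i * a i.
Proof.
pose g (h : V) := \sum_i h 0 i * a i.
have lg : linear g.
  move=> c x y; rewrite /g scaler_sumr -big_split/=; apply: eq_bigr => i _.
  by rewrite !mxE mulrDl [c *: _]mulrA.
pose L := GRing.isLinear.Build R V R *:%R g lg.
pose df : {linear V -> R} := HB.pack g L.
exists df; split => // x; apply: differentiable_continuous.
rewrite /df /= /g.
rewrite (_ : (fun h : V => _) = \sum_i (fun h : V => h 0 i *: a i)); last first.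
  by apply/funext => h; rewrite fct_sumE.
by apply: differentiable_sum => i; apply: differentiableZl; exact: differentiable_coord.
Qed.

(* [x] and [x + h] are joined by the path that changes one coordinate at a
   time, and the mean value theorem is applied to each step. *)
Lemma near_pd_differentiable f x :
  (\forall y \near x, forall i, derivable f y (delta_mx 0 i)) ->
  (forall i, {for x, continuous (pd i f)}) ->
  differentiable f x /\ forall v, 'd f x v = \sum_i v 0 i * pd i f x.
Proof.
move=> fd fc; have [df [dfc dfE]] := row_sum_pd (fun i => pd i f x).
suff fE : f \o shift x = cst (f x) + df +o_ 0 id.
  have E := diff_unique dfc fE.
  split; last by move=> v; rewrite E dfE.
  by apply/diff_locallyP; rewrite E.
apply/eqaddoP => _ /posnumP[e].
(* Each of the [n] coordinate steps costs at most [d] times the norm of [h]; dividing by [n.+1]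
   instead of [n] also covers dimension 0. *)
pose d := e%:num / n.+1%:R.
have d0 : 0 < d by rewrite divr_gt0.
have /nbhs_ballP[r /= r0 Hr] : \forall y \near x, forall i,
    derivable f y (delta_mx 0 i) /\ `|pd i f x - pd i f y| <= d.
  near=> y => i; split; first by move: i; near: y.
  move: i; near: y; apply: filter_forall => i.
  have /cvgr_dist_le := fc i; apply; exact: d0.
have nr : \forall h \near (0 : V), `|h| < r by exact: nbhs0_lt.
near=> h.
have hr : `|h| < r by near: h; exact: nr.
(* [hk k] keeps the first [k] coordinates of [h]: the path starts at [hk 0 = 0] and ends at
   [hk n = h]. *)
pose hk k : V := \row_i (if (i < k)%N then h 0 i else 0).
have hk_le k i s : `|s| <= `|h 0 i| -> `|hk k + s *: delta_mx 0 i| <= `|h| \/ (i < k)%N.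
  move=> sh; have [ik|ki] := ltnP i k; [by right|left].
  apply: rV_norm_leP => // j; rewrite !mxE eqxx/= mulr_natr.
  have [->|ji] := eqVneq j i.
    by rewrite ltnNge ki/= add0r mulr1n (le_trans sh)// rV_norm_le.
  by rewrite mulr0n addr0; case: ifP => _; rewrite ?normr0// rV_norm_le.
have step (i : 'I_n) : `|f (x + hk i.+1) - f (x + hk i) - h 0 i * pd i f x| <= d * `|h|.
  have inb s : `|s| <= `|h 0 i| -> ball x r (x + hk i + s *: delta_mx 0 i).
    move=> /(hk_le i i)[|]; last by rewrite ltnn.
    rewrite -ball_normE/= -addrA opprD addNKr normrN => /le_lt_trans; exact.
  have [s|s sh] := @MVT_line _ _ f (x + hk i) (delta_mx 0 i) (h 0 i).
    by move=> /inb /Hr /(_ i)[].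
  have -> : x + hk i + h 0 i *: delta_mx 0 i = x + hk i.+1.
    rewrite -addrA; congr (_ + _); apply/rowP => j; rewrite !mxE eqxx/= mulr_natr.
    rewrite ltnS; have [->|ji] := eqVneq j i; first by rewrite ltnn leqnn add0r mulr1n.
    by rewrite mulr0n addr0 ltn_neqAle (inj_eq val_inj) ji.
  move=> ->; rewrite -mulrBr normrM mulrC ler_pM// ?rV_norm_le// distrC.
  by have /inb/Hr/(_ i)[] := sh.
rewrite /= !fctE/= dfE.
have -> : f (h + x) = f (x + hk n).
  by rewrite addrC; congr (f (_ + _)); apply/rowP => i; rewrite !mxE ltn_ord.
have -> : f (x + hk n) = f x + \sum_(i < n) (f (x + hk i.+1) - f (x + hk i)).
  rewrite -(big_mkord xpredT (fun i => f (x + hk i.+1) - f (x + hk i))).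
  rewrite (@telescope_sumr _ 0 n (fun k => f (x + hk k)))//.
  suff -> : hk 0%N = 0 by rewrite addr0 addrCA subrr addr0.
  by apply/rowP => i; rewrite !mxE.
rewrite opprD addrACA subrr add0r -sumrB (le_trans (ler_norm_sum _ _ _))//.
apply: (@le_trans _ _ (\sum_(i < n) d * `|h|)); first by apply: ler_sum => i _; exact: step.
rewrite sumr_const card_ord -[_ *+ n]mulr_natl mulrA ler_wpM2r//.
rewrite /d mulrCA ler_piMr// ler_pdivrMr// mul1r ler_nat//.
Unshelve. all: by end_near. Qed.

(** Differentiability is recorded next to the continuity of the partials, so that sums, products and
    compositions need not return to the mean value theorem; [C1on_pdI] recovers it on open sets. *)
Definition C1on U f := forall x, U x ->
  differentiable f x /\ forall i, {for x, continuous (pd i f)}.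

Lemma near_eq_continuous (T S : topologicalType) (f g : T -> S) (x : T) :
  (\forall y \near x, f y = g y) -> {for x, continuous f} -> {for x, continuous g}.
Proof.
move=> fg fc; rewrite /prop_for /continuous_at -(nbhs_singleton fg).
by apply: cvg_trans fc; exact: near_eq_cvg.
Qed.

Lemma continuous_sum_fun (T : topologicalType) (I : Type) (r : seq I) (F : I -> T -> R)
    (x : T) : (forall j, {for x, continuous (F j)}) ->
  {for x, continuous (fun y => \sum_(j <- r) F j y)}.
Proof.
move=> Fc; elim: r => [|j r IH].
  apply: (@near_eq_continuous _ _ (fun=> 0)); last exact: cst_continuous.
  by apply: nearW => y; rewrite big_nil.
apply: (@near_eq_continuous _ _ (fun y => F j y + \sum_(j <- r) F j y)).
  by apply: nearW => y; rewrite big_cons.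
exact: continuousD.
Qed.

Lemma continuous_dist_le (T : topologicalType) (f : T -> R) (x : T) (e : R) :
  {for x, continuous f} -> 0 < e -> \forall y \near x, `|f x - f y| <= e.
Proof. by move=> /cvgr_dist_le; apply. Qed.

Lemma near_eq_differentiable f g x :
  (\forall y \near x, f y = g y) -> differentiable f x -> differentiable g x.
Proof.
move=> fg /diff_locallyP[dc de].
have gE : g \o shift x = cst (g x) + 'd f x +o_ 0 id.
  have nfg : \forall h \near (0 : V), f (h + x) = g (h + x).
    by move: (fg); rewrite (near_shift 0) subr0.
  apply/eqaddoP => e e0; have /eqaddoP/(_ e e0) := de.
  rewrite -(nbhs_singleton fg); apply: filterS2 nfg.
  by move=> h /= E; rewrite !fctE/= E.
by apply/diff_locallyP; rewrite (diff_unique dc gE).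
Qed.

Lemma near_eq_pd f g x i : (\forall y \near x, f y = g y) -> pd i f x = pd i g x.
Proof. exact: near_eq_derive. Qed.

Section rules.
Variables (x : V) (i : 'I_n).
Implicit Types g : V -> R.

Lemma pd_cst (c : R) : pd i (fun=> c) x = 0.
Proof. by rewrite /pd derive_cst. Qed.

Lemma pdD f g : differentiable f x -> differentiable g x ->
  pd i (fun y => f y + g y) x = pd i f x + pd i g x.
Proof. by move=> df dg; rewrite /pd [LHS]deriveD//; exact: diff_derivable. Qed.

Lemma pdB f g : differentiable f x -> differentiable g x ->
  pd i (fun y => f y - g y) x = pd i f x - pd i g x.
Proof. by move=> df dg; rewrite /pd [LHS]deriveB//; exact: diff_derivable. Qed.

Lemma pdM f g : differentiable f x -> differentiable g x ->
  pd i (fun y => f y * g y) x = pd i f x * g x + f x * pd i g x.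
Proof.
move=> df dg; rewrite /pd [LHS]deriveM; [|exact: diff_derivable..].
by rewrite addrC [g x *: _]mulrC.
Qed.

Lemma pdMl (c : R) f : differentiable f x -> pd i (fun y => c * f y) x = c * pd i f x.
Proof. by move=> df; rewrite pdM// pd_cst mul0r add0r. Qed.

Lemma pdV f : f x != 0 -> differentiable f x ->
  pd i (fun y => (f y)^-1) x = - (f x) ^- 2 * pd i f x.
Proof. by move=> f0 df; rewrite /pd [LHS]deriveV//; exact: diff_derivable. Qed.

Lemma diff_sum (I : Type) (r : seq I) (F : I -> V -> R) :
  (forall j, differentiable (F j) x) -> differentiable (fun y => \sum_(j <- r) F j y) x.
Proof.
move=> dF; elim: r => [|j r IH].
  by rewrite (_ : (fun _ => _) = cst 0)//; apply/funext => y; rewrite big_nil.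
rewrite (_ : (fun _ => _) = F j + (fun y => \sum_(j <- r) F j y)).
  exact: differentiableD.
by apply/funext => y; rewrite big_cons.
Qed.

Lemma pd_sum (I : Type) (r : seq I) (F : I -> V -> R) :
  (forall j, differentiable (F j) x) ->
  pd i (fun y => \sum_(j <- r) F j y) x = \sum_(j <- r) pd i (F j) x.
Proof.
move=> dF; elim: r => [|j r IH].
  by under [in LHS]eq_fun do rewrite big_nil; rewrite big_nil pd_cst.
under [in LHS]eq_fun do rewrite big_cons.
by rewrite pdD ?big_cons ?IH//; exact: diff_sum.
Qed.

End rules.

(** Since [U] is open, the partials near a point may be replaced by any formula valid on [U]; the
    rules below supply that formula as [g]. *)
Lemma C1onI U f : open U -> (forall x, U x -> differentiable f x) ->
  (forall i, exists g : V -> R, forall x, U x -> pd i f x = g x /\ {for x, continuous g}) ->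
  C1on U f.
Proof.
move=> oU df pf x Ux; split; first exact: df.
move=> i; have [g gP] := pf i; apply: near_eq_continuous (gP x Ux).2.
by near=> y; rewrite (gP y _).1//; near: y; exact: open_nbhs_nbhs.
Unshelve. all: by end_near. Qed.

Lemma eq_C1on U f g : open U -> (forall x, U x -> f x = g x) -> C1on U f -> C1on U g.
Proof.
move=> oU fg fC.
have nfg x : U x -> \forall y \near x, f y = g y.
  by move=> Ux; near=> y; apply: fg; near: y; exact: open_nbhs_nbhs.
apply: C1onI => // [x Ux|i].
  by apply: near_eq_differentiable (nfg x Ux) _; have [] := fC x Ux.
exists (pd i f) => x Ux; split; last by have [_] := fC x Ux; apply.
by apply: near_eq_pd; near do apply/esym; exact: nfg.
Unshelve. all: by end_near. Qed.

Lemma C1on_diff U f x : C1on U f -> U x -> differentiable f x.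
Proof. by move=> fC /fC[]. Qed.

Lemma C1on_cont U f x : C1on U f -> U x -> {for x, continuous f}.
Proof. by move=> fC /fC[df _]; exact: differentiable_continuous. Qed.

Lemma C1on_pd U f x i : C1on U f -> U x -> {for x, continuous (pd i f)}.
Proof. by move=> fC /fC[_]. Qed.

Lemma C1on_cst U (c : R) : C1on U (fun=> c).
Proof.
move=> x _; split; first exact: differentiable_cst.
move=> i; rewrite (_ : pd i _ = cst 0); first exact: cst_continuous.
by apply/funext => y; rewrite pd_cst.
Qed.

Lemma C1onD U f g : open U -> C1on U f -> C1on U g -> C1on U (fun x => f x + g x).
Proof.
move=> oU fC gC; have df := C1on_diff fC; have dg := C1on_diff gC.
apply: C1onI => // [x Ux|i].
  by apply: (@differentiableD _ _ _ f g); [exact: df|exact: dg].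
exists (fun x => pd i f x + pd i g x) => x Ux; split.
  by rewrite pdD//; [exact: df|exact: dg].
by apply: continuousD; [exact: C1on_pd fC _|exact: C1on_pd gC _].
Qed.

Lemma C1onM U f g : open U -> C1on U f -> C1on U g -> C1on U (fun x => f x * g x).
Proof.
move=> oU fC gC; have df := C1on_diff fC; have dg := C1on_diff gC.
apply: C1onI => // [x Ux|i].
  by apply: (@differentiableM _ _ f g); [exact: df|exact: dg].
exists (fun x => pd i f x * g x + f x * pd i g x) => x Ux; split.
  by rewrite pdM//; [exact: df|exact: dg].
apply: continuousD; apply: continuousM.
- exact: C1on_pd fC _.
- exact: C1on_cont gC _.
- exact: C1on_cont fC _.
- exact: C1on_pd gC _.
Qed.

Lemma C1onN U f : open U -> C1on U f -> C1on U (fun x => - f x).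
Proof.
move=> oU fC; apply: (@eq_C1on U (fun x => -1 * f x)) => //.
  by move=> x _; rewrite mulN1r.
by apply: C1onM => //; exact: C1on_cst.
Qed.

Lemma C1onB U f g : open U -> C1on U f -> C1on U g -> C1on U (fun x => f x - g x).
Proof. by move=> oU fC gC; exact: C1onD oU fC (C1onN oU gC). Qed.

Lemma C1on_sum U (I : Type) (r : seq I) (F : I -> V -> R) : open U ->
  (forall j, C1on U (F j)) -> C1on U (fun x => \sum_(j <- r) F j x).
Proof.
move=> oU FC; elim: r => [|j r IH].
  by apply: (@eq_C1on U (fun=> 0)) => //; [move=> x _; rewrite big_nil|exact: C1on_cst].
apply: (@eq_C1on U (fun x => F j x + \sum_(j <- r) F j x)) => //.
  by move=> x _; rewrite big_cons.
exact: C1onD.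
Qed.

Lemma C1on_prod U (I : Type) (r : seq I) (F : I -> V -> R) : open U ->
  (forall j, C1on U (F j)) -> C1on U (fun x => \prod_(j <- r) F j x).
Proof.
move=> oU FC; elim: r => [|j r IH].
  by apply: (@eq_C1on U (fun=> 1)) => //; [move=> x _; rewrite big_nil|exact: C1on_cst].
apply: (@eq_C1on U (fun x => F j x * \prod_(j <- r) F j x)) => //.
  by move=> x _; rewrite big_cons.
exact: C1onM.
Qed.

Lemma C1onV U f : open U -> (forall x, U x -> f x != 0) ->
  C1on U f -> C1on U (fun x => (f x)^-1).
Proof.
move=> oU f0 fC; have df := C1on_diff fC; have cf := C1on_cont fC.
apply: C1onI => // [x Ux|i].
  by apply: differentiableV; [exact: df|exact: f0].
exists (fun x => - (f x) ^- 2 * pd i f x) => x Ux; split.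
  by rewrite pdV//; [exact: f0|exact: df].
apply: continuousM; last exact: C1on_pd fC _.
apply: continuousN; apply: continuousV; first by rewrite expf_neq0// f0.
by apply: (@continuousM _ _ f f); exact: cf.
Qed.

Lemma smooth_on_pd U f i : smooth_on U f -> smooth_on U (pd i f).
Proof. by move=> fS s; have := fS (rcons s (delta_mx 0 i)); rewrite /iter_derive foldr_rcons. Qed.

Lemma C1on_pdI U f : open U ->
  (forall x, U x -> forall i, derivable f x (delta_mx 0 i)) ->
  (forall x, U x -> forall i, {for x, continuous (pd i f)}) -> C1on U f.
Proof.
move=> oU fd fc x Ux; split; last exact: fc.
apply: (near_pd_differentiable _ (fc x Ux)).1.
by near=> y; apply: fd; near: y; exact: open_nbhs_nbhs.
Unshelve. all: by end_near. Qed.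

Lemma smooth_C1on U f : open U -> smooth_on U f -> C1on U f.
Proof.
move=> oU fS; apply: C1on_pdI => // x Ux i; first exact: (fS [::] x Ux).2.
by have [] := fS [:: delta_mx 0 i] x Ux.
Qed.

Lemma C1on_diffE U f x v : C1on U f -> U x -> open U ->
  'd f x v = \sum_i v 0 i * pd i f x.
Proof.
move=> fC Ux oU; apply: (near_pd_differentiable _ (fC x Ux).2).2.
near=> y => i; apply: diff_derivable; apply: (C1on_diff fC).
by near: y; exact: open_nbhs_nbhs.
Unshelve. all: by end_near. Qed.

Lemma C1on_pd_eq0 U f x i : open U -> U x -> (forall y, U y -> f y = 0) -> pd i f x = 0.
Proof.
move=> oU Ux f0; rewrite (@near_eq_pd f (fun=> 0)) ?pd_cst//.
by near=> y; apply: f0; near: y; exact: open_nbhs_nbhs.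
Unshelve. all: by end_near. Qed.

Lemma C1on_comp1 U f (h dh : R -> R) : open U -> C1on U f ->
  (forall x, U x -> is_derive (f x) 1 h (dh (f x)) /\ {for f x, continuous dh}) ->
  C1on U (h \o f) /\ forall x i, U x -> pd i (h \o f) x = dh (f x) * pd i f x.
Proof.
move=> oU fC hP.
have dhf x : U x -> differentiable h (f x).
  by move=> /hP[dh1 _]; apply/derivable1_diffP; exact: ex_derive.
have dhE x : U x -> forall v, 'd h (f x) v = v * dh (f x).
  move=> Ux v; rewrite -[v in LHS]mulr1 linearZ/= -deriveE; last exact: dhf.
  by congr (_ * _); have [hd _] := hP x Ux; exact: derive_val.
have dcomp x : U x -> differentiable (h \o f) x.
  by move=> Ux; apply: differentiable_comp; [exact: C1on_diff fC _|exact: dhf].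
have pE x i : U x -> pd i (h \o f) x = dh (f x) * pd i f x.
  move=> Ux; have dfx := C1on_diff fC Ux.
  rewrite /pd deriveE; last exact: dcomp.
  by rewrite diff_comp//=; [rewrite dhE// deriveE// mulrC|exact: dhf].
split => //; apply: C1onI => // i.
exists (fun x => dh (f x) * pd i f x) => x Ux; split; first exact: pE.
apply: continuousM; last exact: C1on_pd fC _.
apply: continuous_comp; first exact: C1on_cont fC _.
by have [] := hP x Ux.
Qed.

Lemma C1on_sqrt U f : open U -> (forall x, U x -> 0 < f x) -> C1on U f ->
  C1on U (fun x => Num.sqrt (f x)) /\
  forall x i, U x -> pd i (fun x => Num.sqrt (f x)) x = (2 * Num.sqrt (f x))^-1 * pd i f x.
Proof.
move=> oU f0 fC.
apply: (@C1on_comp1 U f Num.sqrt (fun r => (2 * Num.sqrt r)^-1)) => // x Ux.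
split; first exact: is_derive1_sqrt (f0 x Ux).
apply: continuousV; first by rewrite mulf_neq0// gt_eqF// sqrtr_gt0 f0.
by apply: continuousM; [exact: cst_continuous|exact: sqrt_continuous].
Qed.

(** * Second derivatives and Schwarz's theorem *)

Definition C2on U f := C1on U f /\ forall i, C1on U (pd i f).

Lemma smooth_C2on U f : open U -> smooth_on U f -> C2on U f.
Proof.
move=> oU fS; split; first exact: smooth_C1on.
by move=> i; apply: smooth_C1on => //; exact: smooth_on_pd.
Qed.

Lemma near_ball_seg U x (v w : V) : open U -> U x ->
  \forall e \near (0 : R), forall s t : R, `|s| <= `|e| -> `|t| <= `|e| ->
    U (x + s *: v + t *: w).
Proof.
move=> oU Ux.
have /nbhs_ballP[r /= r0 Hr] : nbhs x U by exact: open_nbhs_nbhs.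
(* The summand 1 keeps the denominator positive when both directions vanish. *)
have c0 : 0 < `|v| + `|w| + 1 by rewrite ltr_wpDl// addr_ge0.
have ne : \forall e \near (0 : R), `|e| < r / (`|v| + `|w| + 1).
  by apply: (@nbhs0_lt _ R^o); exact: divr_gt0.
near=> e => s t se te; apply: Hr; rewrite -ball_normE/= -addrA opprD addNKr normrN.
rewrite (le_lt_trans (ler_normD _ _))// !normrZ.
apply: (@le_lt_trans _ _ (`|e| * (`|v| + `|w| + 1))).
  rewrite !mulrDr mulr1 -[leLHS]addr0 lerD//.
  by rewrite lerD// ler_wpM2r.
rewrite -ltr_pdivlMr//; near: e; exact: ne.
Unshelve. all: by end_near. Qed.

Lemma pd_shift f i (a y : V) : pd i (fun z => f (z + a)) y = pd i f (y + a).
Proof.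
rewrite /pd /derive; set F1 := (fun h : R => _); set F2 := (fun h : R => _).
by suff -> : F1 = F2 by []; apply/funext => h; rewrite /F1 /F2 /= addrA.
Qed.

(* Both mixed derivatives in Schwarz's theorem [pd_comm] are limits of this quotient. *)
Lemma double_increment U f x i j (e : R) : open U -> C2on U f ->
  (forall s t : R, `|s| <= `|e| -> `|t| <= `|e| ->
    U (x + s *: delta_mx 0 i + t *: delta_mx 0 j)) ->
  exists s t : R, [/\ `|s| <= `|e|, `|t| <= `|e| &
    f (x + e *: delta_mx 0 i + e *: delta_mx 0 j) - f (x + e *: delta_mx 0 i)
    - (f (x + e *: delta_mx 0 j) - f x) =
    e * (e * pd j (pd i f) (x + s *: delta_mx 0 i + t *: delta_mx 0 j))].
Proof.
move=> oU [fC fC2] xU; set vi : V := delta_mx 0 i; set vj : V := delta_mx 0 j.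
have Ui s : `|s| <= `|e| -> U (x + s *: vi).
  by move=> se; have := xU s 0 se; rewrite scale0r addr0 normr0; apply.
(* The double increment is a single increment of [h] along [i]; the mean value theorem leaves an
   increment of [pd i f] along [j], to which it is applied again. *)
pose h y := f (y + e *: vj) - f y.
have shift_diff y : differentiable (fun z : V => z + e *: vj) y.
  by apply: (@differentiableD _ _ _ id (cst (e *: vj))).
have hd s : `|s| <= `|e| -> differentiable h (x + s *: vi) /\
    pd i h (x + s *: vi) = pd i f (x + s *: vi + e *: vj) - pd i f (x + s *: vi).
  move=> se.
  have d1 : differentiable f (x + s *: vi + e *: vj) by apply: (C1on_diff fC); exact: xU.
  have d2 : differentiable f (x + s *: vi) by apply: (C1on_diff fC); exact: Ui.
  have d3 : differentiable (fun y => f (y + e *: vj)) (x + s *: vi).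
    exact: (@differentiable_comp _ _ _ _ (fun z : V => z + e *: vj) f).
  split; first exact: differentiableB.
  by rewrite /h (pdB i d3 d2) pd_shift.
have [s se E1] := @MVT_line _ _ h x vi e (fun s se => diff_derivable (hd s se).1).
have [t te E2] := @MVT_line _ _ (pd i f) (x + s *: vi) vj e
  (fun t te => diff_derivable (C1on_diff (fC2 i) (xU s t se te))).
exists s, t; split => //.
by rewrite -/(h (x + e *: vi)) -/(h x) E1 -/(pd i h _) (hd s se).2 E2.
Qed.

(** The double increment is unchanged when the intermediate corners [b] and [c] trade places; this
    is where the two orders of differentiation meet. *)
Lemma cross_difference_inj (a b c k d p q : R) : d != 0 ->
  a - b - (c - k) = d * (d * p) -> a - c - (b - k) = d * (d * q) -> p = q.
Proof.
move=> d0 E1 E2; apply: (mulfI d0); apply: (mulfI d0); rewrite -E1 -E2; ring.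
Qed.

Lemma dist_halves (a b c e : R) :
  `|a - c| <= e / 2 -> `|b - c| <= e / 2 -> `|a - b| <= e.
Proof. by rewrite !ler_norml; lra. Qed.

(** One double increment over a small square, divided by the squared side, equals both mixed
    derivatives, each at its own point of the square; continuity at [x] brings each within [e / 2]
    of its value there. *)
Lemma pd_comm U f x i j : open U -> C2on U f -> U x ->
  pd i (pd j f) x = pd j (pd i f) x.
Proof.
move=> oU fC Ux; apply/eqP; rewrite -subr_eq0 -normr_le0.
apply/ler_addgt0Pr => e e0; rewrite add0r.
have cc k l : {for x, continuous (pd k (pd l f))}.
  by have [_] := fC.2 l x Ux; apply.
have e20 : 0 < e / 2 by rewrite divr_gt0.
have /nbhs_ballP[r /= r0 Hr] :
    \forall y \near x, `|pd i (pd j f) x - pd i (pd j f) y| <= e / 2 /\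
                       `|pd j (pd i f) x - pd j (pd i f) y| <= e / 2.
  have ci := continuous_dist_le (cc i j) e20.
  have cj := continuous_dist_le (cc j i) e20.
  exact: filterS2 (fun y a b => conj a b) ci cj.
(* Inside [W] every intermediate point lies in the ball where the continuity estimates hold. *)
pose W := U `&` ball x r.
have oW : open W by apply: openI => //; exact: ball_open.
have Wx : W x by split => //; exact: ballxx.
have [d d0 Hd] : exists2 d : R, 0 < d &
    (forall s t : R, `|s| <= `|d| -> `|t| <= `|d| ->
      W (x + s *: delta_mx 0 i + t *: delta_mx 0 j)) /\
    (forall s t : R, `|s| <= `|d| -> `|t| <= `|d| ->
      W (x + s *: delta_mx 0 j + t *: delta_mx 0 i)).
  have /nbhs_ballP[q /= q0 Hq] : nbhs (0 : R) [set d : R |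
    (forall s t : R, `|s| <= `|d| -> `|t| <= `|d| ->
      W (x + s *: delta_mx 0 i + t *: delta_mx 0 j)) /\
    (forall s t : R, `|s| <= `|d| -> `|t| <= `|d| ->
      W (x + s *: delta_mx 0 j + t *: delta_mx 0 i))].
    have ni := near_ball_seg (delta_mx 0 i) (delta_mx 0 j) oW Wx.
    have nj := near_ball_seg (delta_mx 0 j) (delta_mx 0 i) oW Wx.
    exact: filterS2 (fun y a b => conj a b) ni nj.
  exists (q / 2); first by rewrite divr_gt0.
  apply: Hq; rewrite -ball_normE/= sub0r normrN gtr0_norm ?divr_gt0//; lra.
have fW : C2on W f.
  by split => [|k] y [Uy _]; [exact: fC.1|exact: fC.2].
have [s [t [se te E1]]] := double_increment oW fW Hd.1.
have [s' [t' [se' te' E2]]] := double_increment oW fW Hd.2.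
have := (Hr _ (Hd.1 s t se te).2).2.
have := (Hr _ (Hd.2 s' t' se' te').2).1.
(* Both expansions must name the far corner of the square in the same way. *)
rewrite (addrAC x (d *: delta_mx 0 j) (d *: delta_mx 0 i)) in E2.
set p := pd j _ _ in E1 *; set q := pd i _ _ in E2 *.
set P := pd i _ _; set Q := pd j _ _.
have -> : p = q by exact: cross_difference_inj (lt0r_neq0 d0) E1 E2.
by move=> Pq Qq; exact: dist_halves Pq Qq.
Qed.

End C1.

Section chain_rule.
Variables (R : realType) (n m : nat).

Lemma diff_row (phi : 'rV[R]_n -> 'rV[R]_m) (x : 'rV[R]_n) :
  (forall k, differentiable (fun y => phi y 0 k) x) ->
  differentiable phi x /\ forall v k, 'd phi x v 0 k = 'd (fun y => phi y 0 k) x v.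
Proof.
move=> dphi; have phiE : phi = \sum_(k < m) (fun y => phi y 0 k *: delta_mx 0 k).
  apply/funext => y; rewrite fct_sumE [LHS]row_sum_delta.
  by apply: eq_bigr.
have dp : differentiable phi x.
  by rewrite phiE; apply: differentiable_sum => k; exact: differentiableZl.
split => // v k.
have coordk : 'd (fun N : 'rV[R]_m => N 0 k : R) (phi x) = (fun N : 'rV[R]_m => N 0 k) :> (_ -> _).
  have lc : linear (fun N : 'rV[R]_m => N 0 k : R) by move=> a A B; rewrite !mxE.
  pose L := GRing.isLinear.Build R 'rV[R]_m R *:%R (fun N : 'rV[R]_m => N 0 k : R) lc.
  pose l : {linear 'rV[R]_m -> R} := HB.pack (fun N : 'rV[R]_m => N 0 k : R) L.
  apply: (@diff_lin _ _ _ l).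
  by move=> y; apply: (@coord_continuous R 1 m 0 k y).
have := @diff_comp _ _ _ _ phi (fun N : 'rV[R]_m => N 0 k : R) x dp
  (@differentiable_coord R 1 m (phi x) 0 k).
by rewrite coordk => /(congr1 (fun h => h v)) /= <-.
Qed.

Lemma pd_comp (U : set 'rV[R]_n) (W : set 'rV[R]_m) (phi : 'rV[R]_n -> 'rV[R]_m)
    (f : 'rV[R]_m -> R) : open U -> open W ->
  (forall k, C1on U (fun y => phi y 0 k)) -> (forall x, U x -> W (phi x)) ->
  C1on W f -> forall x, U x -> differentiable (fun y => f (phi y)) x /\ forall i,
    pd i (fun y => f (phi y)) x = \sum_k pd i (fun y => phi y 0 k) x * pd k f (phi x).
Proof.
move=> oU oW phiC UW fC x Ux.
have dphik k : differentiable (fun y => phi y 0 k) x by exact: C1on_diff (phiC k) Ux.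
have [dphi dphiE] := diff_row dphik.
have df : differentiable f (phi x) by exact: C1on_diff fC (UW _ Ux).
have dc : differentiable (f \o phi) x by exact: differentiable_comp.
split; first exact: dc.
move=> i; rewrite /pd (deriveE _ dc) (diff_comp dphi df) /=.
rewrite (C1on_diffE _ fC (UW _ Ux) oW); apply: eq_bigr => k _.
by rewrite dphiE (deriveE _ (dphik k)).
Qed.

Lemma C1on_comp (U : set 'rV[R]_n) (W : set 'rV[R]_m) (phi : 'rV[R]_n -> 'rV[R]_m)
    (f : 'rV[R]_m -> R) : open U -> open W ->
  (forall k, C1on U (fun y => phi y 0 k)) -> (forall x, U x -> W (phi x)) ->
  C1on W f -> C1on U (fun y => f (phi y)).
Proof.
move=> oU oW phiC UW fC; have pc := pd_comp oU oW phiC UW fC.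
apply: C1onI => // [x Ux|i]; first exact: (pc x Ux).1.
exists (fun x => \sum_k pd i (fun y => phi y 0 k) x * pd k f (phi x)) => x Ux.
split; first exact: (pc x Ux).2.
apply: continuous_sum_fun => k; apply: continuousM; first exact: C1on_pd (phiC k) _.
apply: continuous_comp; last exact: C1on_pd fC (UW _ Ux).
apply: differentiable_continuous.
by apply: (diff_row _).1 => l; exact: C1on_diff (phiC l) Ux.
Qed.

End chain_rule.

(** * Lebesgue integration over row vectors *)

Section borel_maps.
Variable R : realType.

Lemma open_preimage_on (T S : topologicalType) (D : set T) (f : T -> S) (B : set S) :
  open D -> (forall x, D x -> {for x, continuous f}) -> open B -> open (D `&` f @^-1` B).
Proof.
move=> oD fc oB; rewrite openE => x [Dx Bx]; apply: filterI.
  exact: open_nbhs_nbhs.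
by apply: (fc x Dx); exact: open_nbhs_nbhs.
Qed.

Lemma borel_open (T : ptopologicalType) (D : set T) : open D ->
  measurable (D : set (borel T)).
Proof. by move=> oD; exact: sub_sigma_algebra. Qed.

Lemma borel_measurable_fun (T S : ptopologicalType) (D : set T) (f : T -> S) :
  open D -> (forall x, D x -> {for x, continuous f}) ->
  measurable_fun (D : set (borel T)) (f : borel T -> borel S).
Proof.
move=> oD fc; apply: (@measurability _ _ (borel T) (borel S) D f (@open S) erefl).
by move=> _ [B oB <-]; apply: borel_open; exact: open_preimage_on.
Qed.

Lemma borel_measurable_funR (T : ptopologicalType) (D : set T) (f : T -> R) :
  open D -> (forall x, D x -> {for x, continuous f}) ->
  measurable_fun (D : set (borel T)) f.
Proof.
move=> oD fc; apply: (measurability _ (RGenOpens.measurableE R)).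
move=> _ [_ [a [b ->] <-]]; apply: borel_open; apply: open_preimage_on => //.
Qed.

Lemma rat_approx (x e : R) : 0 < e -> exists q : rat, `|x - ratr q| < e.
Proof.
move=> e0; have xe : x - e < x + e by lra.
have [q] := rat_in_itvoo xe; rewrite in_itv/= => /andP[q1 q2].
by exists q; rewrite ltr_norml; apply/andP; split; lra.
Qed.

(** The source carries the product sigma-algebra, generated by rectangles, the target the Borel one,
    generated by open sets. They match because an open set is a countable union of boxes with
    rational centres and radii [k.+1%:R^-1]. *)
Lemma measurable_row_mx n : measurable_fun [set: measurableTypeR R * borel 'rV[R]_n]
  (fun z => row_mx (z.1%:M : 'M[R]_1) z.2 : borel 'rV[R]_(1 + n)).
Proof.
apply: (@measurability _ _ _ (borel 'rV[R]_(1 + n)) _ _ (@open 'rV[R]_(1 + n)) erefl).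
move=> _ [B oB <-]; rewrite setTI.
pose box (c : (rat * 'rV[rat]_n) * nat) : set (measurableTypeR R * borel 'rV[R]_n) :=
  (ball (ratr c.1.1 : R) c.2.+1%:R^-1) `*`
  (ball (map_mx ratr c.1.2 : 'rV[R]_n) c.2.+1%:R^-1).
pose f (z : measurableTypeR R * borel 'rV[R]_n) := row_mx (z.1%:M : 'M[R]_1) z.2.
have -> : f @^-1` B = \bigcup_c (if `[< box c `<=` f @^-1` B >] then box c else set0).
  apply/seteqP; split => [z Bz|z [c _]]; last by case: asboolP => // sub cz; exact: sub.
  have /nbhs_ballP[e /= e0 He] : nbhs (f z) B by exact: open_nbhs_nbhs.
  (* With radius below [e / 2], two points of one box are within [e] of each other, so a box
     containing [z] stays in the preimage of [B]. *)
  have [k kE] : exists k : nat, (k.+1%:R^-1 : R) < e / 2.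
    have [k] := @ltr_add_invr _ 0 (e / 2) (divr_gt0 e0 (ltr0Sn _ 1)).
    by rewrite add0r => kE; exists k.
  have k0 : (0 : R) < k.+1%:R^-1 by rewrite invr_gt0.
  have [q qE] := rat_approx z.1 k0.
  have /choice[r rE] i := rat_approx ((z.2 : 'rV[R]_n) 0 i) k0.
  pose c := ((q, \row_i r i) : rat * 'rV[rat]_n, k).
  have zc : box c z.
    split; first by rewrite -ball_normE/= distrC.
    split => // i j; rewrite ord1 !mxE/= -ball_normE/= distrC; exact: rE.
  exists c => //; case: asboolP => // -[].
  move=> y [y1 [_ y2]]; apply: He; split => // i j; rewrite !ord1 /f.
  have tri a b d : ball a k.+1%:R^-1 b -> ball a k.+1%:R^-1 d -> ball (b : R) e d.
    rewrite -!ball_normE/= => ab ad; rewrite (le_lt_trans (ler_distD a _ _))//.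
    by rewrite (splitr e) ltrD// ?(lt_trans _ kE)// distrC.
  rewrite !mxE; case: splitP => l _; first by rewrite !ord1 !mxE !eqxx; exact: tri zc.1 y1.
  by have [_ [_ /(_ 0 l)]] := zc; move=> /tri; apply; exact: y2.
apply: countable_bigcupT_measurable; first exact: countableP.
move=> c; case: asboolP => // _; apply: measurableX.
  by apply: open_measurable; exact: ball_open.
by apply: borel_open; exact: ball_open.
Qed.

End borel_maps.

(** Sigma-finiteness has to be carried through the induction of [lebesgue_int_measure], since
    Tonelli's theorem asks for it in every dimension. *)
Lemma sigma_finite_pushforward d d' (T : measurableType d) (T' : measurableType d')
    (R : realType) (mu : {measure set T -> \bar R}) (f : T -> T')
    (mf : measurable_fun setT f) (s : sigma_finite setT (pushforward mu f)) :
  exists m : {sigma_finite_measure set T' -> \bar R}, forall A, m A = pushforward mu f A.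
Proof.
pose m : {measure set T' -> \bar R} :=
  measure_function_pushforward__canonical__measure_function_Measure mu mf.
pose S := @Measure_isSigmaFinite.Build _ T' R m s.
pose m' : {sigma_finite_measure set T' -> \bar R} := HB.pack (pushforward mu f) m S.
by exists (m' mf).
Qed.

Section lebesgue_int_measure.
Variable R : realType.

(* Realizes the iterated integral by a measure, so that Tonelli, Fubini and
   dominated convergence apply to it. *)
Lemma lebesgue_int_measure n :
  exists lam : {sigma_finite_measure set (borel 'rV[R]_n) -> \bar R},
  forall f : borel 'rV[R]_n -> \bar R, measurable_fun setT f ->
    (forall x, 0 <= f x)%E -> (\int[lam]_x f x)%E = lebesgue_int f.
Proof.
elim: n => [|n [lam lamE]].
  exists (\d_ (0 : borel 'rV[R]_0) : {sigma_finite_measure set (borel 'rV[R]_0) -> \bar R}).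
  by move=> f mf f0; rewrite integral_dirac// diracE in_setT mul1e.
pose leb : {sigma_finite_measure set _ -> \bar R} := @lebesgue_measure R.
pose nu : {measure set _ -> \bar R} := (leb \x lam)%E.
pose phi (z : measurableTypeR R * borel 'rV[R]_n) : borel 'rV[R]_n.+1 :=
  row_mx (z.1%:M : 'M[R]_1) z.2.
have mphi : measurable_fun setT phi  by exact: measurable_row_mx.
(* The left inverse [psi] of [phi] turns a sigma-finite cover for [nu] into one for its
   push-forward. *)
pose psi (x : borel 'rV[R]_n.+1) : measurableTypeR R * borel 'rV[R]_n :=
  ((x : 'rV[R]_(1 + n)) 0 (lshift n 0), rsubmx (x : 'rV[R]_(1 + n))).
have mpsi : measurable_fun setT psi.
  apply: measurable_fun_pair.
    apply: borel_measurable_funR; first exact: openT.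
    by move=> x _; apply: (@coord_continuous R 1 (1 + n) 0 (lshift n 0) x).
  apply: borel_measurable_fun; first exact: openT.
  by move=> x _; exact: (@continuous_rsubmx R 1 1 n x).
have phiK : cancel phi psi.
  case=> t x; rewrite /phi /psi /=; congr (_, _); last by rewrite row_mxKr.
  by rewrite row_mxEl mxE eqxx mulr1n.
have [F FT Ffin] : sigma_finite setT nu.
  have [F FT Ffin] := sigma_finiteT leb; have [G GT Gfin] := sigma_finiteT lam.
  pose FG k := if unpickle k is Some ij then F ij.1 `*` G ij.2 else set0.
  exists FG => [|k].
    apply/esym; rewrite -subTset => -[t x] _.
    have [i _ Fi] : (\bigcup_i F i) t by rewrite -FT.
    have [j _ Gj] : (\bigcup_j G j) x by rewrite -GT.
    by exists (pickle (i, j)); rewrite // /FG pickleK.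
  rewrite /FG; case: unpickle => [[i j]/=|]; last by rewrite measure0.
  have [mF Foo] := Ffin i; have [mG Goo] := Gfin j.
  split; first exact: measurableX.
  by rewrite /nu /= product_measure1E// lte_mul_pinfty// ge0_fin_numE.
have [|m mE] := @sigma_finite_pushforward _ _ _ _ _ nu phi mphi.
  exists (fun i => psi @^-1` F i).
    by rewrite -preimage_bigcup -FT preimage_setT.
  move=> i; split; first by rewrite -[X in measurable X]setTI; apply: mpsi => //; exact: (Ffin i).1.
  rewrite /pushforward -comp_preimage (_ : psi \o phi = id); first exact: (Ffin i).2.
  by apply/funext => z; exact: phiK.
exists m => f mf f0.
rewrite (eq_measure_integral (pushforward nu phi)); last by move=> A _ _; exact: mE.
rewrite ge0_integral_pushforward// preimage_setT fubini_tonelli1//=; last exact: (measurableT_comp mf mphi).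
apply: eq_integral => t _; rewrite /fubini_F -[RHS]lamE//.
exact: (measurableT_comp mf (measurableT_comp mphi (measurable_pair1 t))).
Qed.

(** Lebesgue measure is determined by its values on half-open intervals, whose lengths translation
    preserves. *)
Lemma ge0_integral_shift (f : measurableTypeR R -> \bar R) (b : R) :
  measurable_fun setT f -> (forall t, 0 <= f t)%E ->
  (\int[@lebesgue_measure R]_t f (t + b)%R = \int[@lebesgue_measure R]_t f t)%E.
Proof.
move=> mf f0; pose phi : measurableTypeR R -> measurableTypeR R := fun t => t + b.
have mphi : measurable_fun setT phi by exact: measurable_funD.
have E A : measurable A -> lebesgue_measure A = pushforward (@lebesgue_measure R) phi A.
  pose m : {measure set (measurableTypeR R) -> \bar R} :=
    measure_function_pushforward__canonical__measure_function_Measure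
      (@lebesgue_measure R) mphi.
  apply: (@lebesgue_measure_unique R m) => _ [[x y] _ <-].
  rewrite /m /= /pushforward.
  have -> : phi @^-1` [set` `]x, y]] = [set` `]x - b, y - b]].
    by apply/seteqP; split => z /=; rewrite !in_itv/= /phi ltrBlDr lerBrDr.
  rewrite !lebesgue_measure_itv/= !lte_fin ltrD2r; case: ifP => // _.
  by rewrite -!EFinD; congr (_%:E); lra.
rewrite [RHS](eq_measure_integral (pushforward (@lebesgue_measure R) phi)); last first.
  by move=> A mA _; exact: E.
by rewrite ge0_integral_pushforward.
Qed.

(** The measurability part of Tonelli's theorem, available once the inner iterated integral is read
    as an integral against a measure. *)
Lemma lebesgue_int_section n (f : borel 'rV[R]_n.+1 -> \bar R) :
  measurable_fun setT f -> (forall x, 0 <= f x)%E ->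
  (forall t, measurable_fun setT
    (fun x : borel 'rV[R]_n => f (row_mx (t%:M : 'M[R]_1) x))) /\
  measurable_fun setT (fun t : measurableTypeR R =>
    lebesgue_int (fun x => f (row_mx (t%:M : 'M[R]_1) x))).
Proof.
move=> mf f0; have [lam lamE] := lebesgue_int_measure n.
have mphi := @measurable_row_mx R n.
have ms t : measurable_fun setT (fun x : borel 'rV[R]_n => f (row_mx (t%:M : 'M[R]_1) x)).
  exact: (measurableT_comp mf (measurableT_comp mphi (measurable_pair1 t))).
split => //; under eq_fun do rewrite -lamE//.
apply: (@measurable_fun_fubini_tonelli_F _ _ (measurableTypeR R) (borel 'rV[R]_n) R lam
  (fun z => f (row_mx (z.1%:M : 'M[R]_1) z.2))) => //.
exact: (measurableT_comp mf mphi).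
Qed.

Lemma lebesgue_int_ge0 n (f : 'rV[R]_n -> \bar R) :
  (forall x, 0 <= f x)%E -> (0 <= lebesgue_int f)%E.
Proof. by elim: n f => [|n IH] f f0 //=; apply: integral_ge0 => t _; exact: IH. Qed.

Lemma lebesgue_int_shift n (f : borel 'rV[R]_n -> \bar R) (a : 'rV[R]_n) :
  measurable_fun setT f -> (forall x, 0 <= f x)%E ->
  lebesgue_int (fun x => f (x + a)) = lebesgue_int f.
Proof.
elim: n f a => [|n IH] f a mf f0 /=; first by rewrite (thinmx0 a) addr0.
have [ms mi] := lebesgue_int_section mf f0.
pose a1 : 'M[R]_1 := lsubmx (a : 'rV[R]_(1 + n)).
pose a2 := rsubmx (a : 'rV[R]_(1 + n)).
have aE t (x : 'rV[R]_n) : row_mx (t%:M : 'M[R]_1) x + (a : 'rV[R]_(1 + n)) =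
    row_mx ((t + a1 0 0)%:M : 'M[R]_1) (x + a2).
  by rewrite -[a in LHS](@hsubmxK _ 1 1 n) add_row_mx [lsubmx _ in LHS]mx11_scalar -raddfD.
under eq_integral.
  move=> t _.
  rewrite (_ : (fun x => _) = (fun x => f (row_mx ((t + a1 0 0)%:M : 'M[R]_1) (x + a2)))).
    rewrite (IH (fun x => f (row_mx ((t + a1 0 0)%:M : 'M[R]_1) x)))//.
    over.
  by apply/funext => x; rewrite aE.
rewrite (@ge0_integral_shift (fun t => lebesgue_int (fun x => f (row_mx (t%:M : 'M[R]_1) x))))//.
by move=> t; exact: lebesgue_int_ge0.
Qed.

Lemma lebesgue_int0 n : lebesgue_int (fun _ : 'rV[R]_n => 0%E) = 0%E.
Proof. by elim: n => //= n IH; under eq_integral do rewrite IH; rewrite integral0. Qed.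

(** Only the finiteness of [c] matters: the norm is the maximum norm, so closed balls are cubes and
    have finite measure. *)
Lemma lebesgue_int_cube n (r : R) : exists c : R, 0 <= c /\
  lebesgue_int (fun x : 'rV[R]_n => (\1_[set x : 'rV[R]_n | forall i, `|x 0 i| <= r] x)%:E)
  = c%:E.
Proof.
elim: n => [|n [c [c0 IH]]] /=.
  by exists 1; split => //; rewrite indicE mem_set// => -[].
exists (c * fine (lebesgue_measure `[- r, r]%classic)); split.
  by rewrite mulr_ge0// fine_ge0.
transitivity (\int[@lebesgue_measure R]_(t in `[(- r)%R, r]%classic) c%:E)%E; last first.
  rewrite integral_cst//= EFinM fineK// lebesgue_measure_itv/=.
  by case: ifP => // _; rewrite -EFinB.
rewrite [RHS]integral_mkcond; apply: eq_integral => t _; rewrite patchE.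
case: ifPn => [|tr].
  rewrite inE/= in_itv/= -ler_norml => tr; rewrite -IH; congr lebesgue_int.
  apply/funext => x; rewrite !indicE.
  have [xr|xr] := pselect (forall i, `|x 0 i| <= r).
    rewrite !mem_set// => i; rewrite !mxE; case: splitP => j _; last exact: xr.
    by rewrite ord1 mxE eqxx.
  rewrite !memNset// => H; apply: xr => i.
  by have := H (rshift 1 i); rewrite (@row_mxEr _ 1 1 n).
rewrite -[RHS](lebesgue_int0 n); congr lebesgue_int.
apply/funext => x; rewrite indicE memNset// => /(_ ord0).
rewrite mxE; case: splitP => // j _; rewrite ord1 mxE eqxx mulr1n => H.
by move/negP: tr; apply; rewrite inE/= in_itv/= -ler_norml.
Qed.

End lebesgue_int_measure.

Lemma integrable_indic_lty d (T : measurableType d) (R : realType)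
    (mu : {measure set T -> \bar R}) (A : set T) : measurable A -> (mu A < +oo)%E ->
  mu.-integrable setT (fun x => (\1_A x)%:E).
Proof.
move=> mA Afin; apply/integrableP; split; first exact/measurable_EFinP/measurable_indic.
under eq_integral do rewrite gee0_abs//.
by rewrite integral_indic// setIT.
Qed.

(** * Integrals of partial derivatives of compactly supported functions *)

Section euclidean_divergence.
Variables (R : realType) (n : nat).
Variable lam : {measure set (borel 'rV[R]_n) -> \bar R}.
Hypothesis lamE : forall f : borel 'rV[R]_n -> \bar R, measurable_fun setT f ->
  (forall x, 0 <= f x)%E -> (\int[lam]_x f x)%E = lebesgue_int f.

Lemma closed_cball_rV (r : R) : closed [set x : 'rV[R]_n | `|x| <= r].
Proof.
have -> : [set x : 'rV[R]_n | `|x| <= r] = (fun x : 'rV[R]_n => `|x|) @^-1` [set y | y <= r].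
  by [].
by apply: closed_comp => [x _|]; [exact: norm_continuous|exact: closed_le].
Qed.

Lemma compact_cball_rV (r : R) : compact [set x : 'rV[R]_n | `|x| <= r].
Proof.
apply: bounded_closed_compact; last exact: closed_cball_rV.
exists r; split; first exact: num_real.
by move=> y ry x /= /le_trans; apply; exact: ltW.
Qed.

Lemma borel_closed (T : ptopologicalType) (D : set T) : closed D ->
  measurable (D : set (borel T)).
Proof.
move=> cD; rewrite -(setCK D); apply: measurableC; apply: borel_open.
exact: closed_openC.
Qed.

Lemma measure_cball_rV (r : R) : (lam [set x : 'rV[R]_n | (`|x| <= r)%R] < +oo)%E.
Proof.
have mB := borel_closed (@closed_cball_rV r).
have [r0|r0] := ltP r 0.
  rewrite (_ : [set x | _] = set0) ?measure0//.
  by rewrite -subset0 => x /= xr; have := le_lt_trans (le_trans (normr_ge0 x) xr) r0; rewrite ltxx.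
rewrite -(setIT [set x | _]) -integral_indic// lamE//; last first.
  exact/measurable_EFinP/measurable_indic.
have [c [c0]] := lebesgue_int_cube n r.
rewrite (_ : [set x : 'rV[R]_n | forall i, `|x 0 i| <= r] = [set x : 'rV[R]_n | `|x| <= r]).
  by move=> ->; rewrite ltry.
apply/seteqP; split => x /= H; first exact: rV_norm_leP.
by move=> i; rewrite (le_trans (rV_norm_le _ _)).
Qed.

Lemma continuous_translation (a : 'rV[R]_n) : continuous (fun x : 'rV[R]_n => x + a).
Proof. by move=> x; apply: (@continuousD _ _ _ id (cst a)); [exact: cvg_id|exact: cst_continuous]. Qed.

Lemma integral_shift_rV (F : borel 'rV[R]_n -> R) (a : 'rV[R]_n) : measurable_fun setT F ->
  (\int[lam]_x (F (x + a)%R)%:E = \int[lam]_x (F x)%:E)%E.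
Proof.
move=> mF; have mshift : measurable_fun setT (fun x : borel 'rV[R]_n => x + a : borel 'rV[R]_n).
  apply: borel_measurable_fun; first exact: openT.
  by move=> x _; exact: continuous_translation.
have H (f : borel 'rV[R]_n -> \bar R) : measurable_fun setT f -> (forall x, 0 <= f x)%E ->
    (\int[lam]_x f (x + a)%R = \int[lam]_x f x)%E.
  move=> mf f0; rewrite !lamE//; first exact: lebesgue_int_shift.
  exact: (measurableT_comp mf mshift).
have mE : measurable_fun setT (EFin \o F) by exact/measurable_EFinP.
(* [lamE] speaks of nonnegative functions only, hence the positive and negative parts. *)
rewrite integralE [RHS]integralE; congr (_ - _)%E.
  by rewrite -[RHS](H _ (measurable_funepos mE))//; apply: eq_integral => x _; rewrite !funeposE.
by rewrite -[RHS](H _ (measurable_funeneg mE))//; apply: eq_integral => x _; rewrite !funenegE.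
Qed.

Lemma continuous_bounded_cball (F : 'rV[R]_n -> R) (r : R) : continuous F ->
  exists2 C : R, 0 <= C & forall x, `|x| <= r -> `|F x| <= C.
Proof.
move=> cF; have [r0|r0] := ltP r 0.
  by exists 0 => // x xr; have := le_lt_trans (le_trans (normr_ge0 x) xr) r0; rewrite ltxx.
have [|||c _ Hc] := @EVT_max_rV R n (fun x => `|F x|) [set x | `|x| <= r].
- by exists 0; rewrite /= normr0.
- exact: compact_cball_rV.
- apply: continuous_subspaceT => x; apply: (continuous_comp (cF x)).
  exact: norm_continuous.
exists `|F c|; first exact: normr_ge0.
by move=> x xr; apply: Hc; rewrite inE.
Qed.

(* The integral of [F (x + h e_k)] does not depend on [h]: differentiate at
   [h = 0]. *)
Lemma integral_pd_eq0 (F : 'rV[R]_n -> R) (k : 'I_n) (r : R) :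
  continuous F -> (forall x, derivable F x (delta_mx 0 k)) -> continuous (pd k F) ->
  (forall x, r < `|x| -> F x = 0) -> (\int[lam]_x (pd k F x)%:E = 0)%E.
Proof.
move=> cF dF cpF F0.
have pF0 x : r < `|x| -> pd k F x = 0.
  move=> rx; apply: (@C1on_pd_eq0 R n (~` [set x | `|x| <= r])) => //=.
  - by apply: closed_openC; exact: closed_cball_rV.
  - by apply/negP; rewrite -ltNge.
  - by move=> y /negP; rewrite -ltNge => /F0.
have [C C0 HC] := continuous_bounded_cball r cpF.
have [C' C'0 HC'] := continuous_bounded_cball r cF.
have mF : measurable_fun setT (F : borel 'rV[R]_n -> R).
  by apply: borel_measurable_funR; [exact: openT|move=> x _; exact: cF].
have mpF : measurable_fun setT (pd k F : borel 'rV[R]_n -> R).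
  by apply: borel_measurable_funR; [exact: openT|move=> x _; exact: cpF].
(* Off the ball of radius [r + 2] all translates with [h] at most 1 in absolute value vanish, so a
   multiple of the indicator of [B] dominates the whole family. *)
pose B : set (borel 'rV[R]_n) := [set x | `|x| <= r + 2].
have mB : measurable B by apply: borel_closed; exact: closed_cball_rV.
have iB c : lam.-integrable setT (EFin \o (fun x => c * \1_B x)).
  rewrite (_ : _ \o _ = (fun x => c%:E * (\1_B x)%:E))%E; last first.
    by apply/funext => x; rewrite /= EFinM.
  apply: integrableZl => //; apply: integrable_indic_lty => //.
  exact: measure_cball_rV.
have shift_le (h : R) (x : 'rV[R]_n) : `|h| <= 1 -> r + 2 < `|x| ->
    r < `|x + h *: delta_mx 0 k|.
  move=> h1 rx.
  have dk : `|delta_mx 0 k : 'rV[R]_n| <= 1.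
    apply: rV_norm_leP => // i; rewrite mxE eqxx/=; case: (i == k);
    by rewrite ?normr1 ?normr0.
  have : `|h *: delta_mx 0 k : 'rV[R]_n| <= 1.
    by rewrite normrZ -[leRHS]mulr1 ler_pM.
  have := ler_normB (x + h *: delta_mx 0 k) (h *: delta_mx 0 k); rewrite addrK.
  lra.
have bnd (G : 'rV[R]_n -> R) (D : R) (h : R) (x : 'rV[R]_n) : 0 <= D ->
    (forall x, `|x| <= r -> `|G x| <= D) -> (forall x, r < `|x| -> G x = 0) ->
    `|h| <= 1 -> `|G (x + h *: delta_mx 0 k)| <= D * \1_B x.
  move=> D0 GD G0 h1; rewrite indicE.
  have [xr|xr] := leP `|x| (r + 2).
    rewrite mem_set// mulr1; have [/GD//|/G0 ->] := leP `|x + h *: delta_mx 0 k| r.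
    by rewrite normr0.
  by rewrite G0 ?normr0; [rewrite mulr_ge0|exact: shift_le].
pose f (h : R) (x : borel 'rV[R]_n) := F (x + h *: delta_mx 0 k).
have fE h : (\int[lam]_x f h x)%R = (\int[lam]_x F x)%R.
  by rewrite /Rintegral; congr fine; exact: integral_shift_rV.
have d1E (h : R) (x : 'rV[R]_n) :
    is_derive h (1 : R) (fun h : R => f h x : R) (pd k F (x + h *: delta_mx 0 k)).
  by apply: is_derive_line; exact: dF.
have I0 : `]-1, 1[%classic (0 : R) by rewrite /= in_itv/= ltrN10 ltr01.
have I1 (h : R) : `]-1, 1[%classic h -> `|h| <= 1.
  by rewrite /= in_itv/= ler_norml => /andP[? ?]; rewrite !ltW.
have partE h x : partial1of2 f h x = pd k F (x + h *: delta_mx 0 k).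
  by rewrite partial1of2E; exact: derive_val.
have intf h : `]-1, 1[%classic h -> lam.-integrable setT (EFin \o f h).
  move=> /I1 h1; apply: (le_integrable _ _ _ (iB C')) => //.
    apply/measurable_EFinP; apply: borel_measurable_funR; first exact: openT.
    move=> x _; apply: continuous_comp; last exact: cF.
    exact: continuous_translation.
  move=> x _; rewrite /= lee_fin [leRHS]ger0_norm ?mulr_ge0//.
  exact: bnd.
have intpF : lam.-integrable setT (EFin \o pd k F).
  apply: (le_integrable _ _ _ (iB C)) => //; first exact/measurable_EFinP.
  move=> x _; rewrite /= lee_fin [leRHS]ger0_norm ?mulr_ge0//.
  by have := bnd _ _ 0 x C0 HC pF0; rewrite normr0 scale0r addr0; apply.
have := @differentiation_under_integral R _ (borel 'rV[R]_n) lam f setT measurableT 0 (-1) 1 I0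
  intf (fun h x _ _ => @ex_derive _ _ _ _ _ _ _ (d1E h x)) (fun x => C * \1_B x) _ (iB C) _.
rewrite (_ : (fun h => _) = cst (\int[lam]_x F x)%R); last by apply/funext => h; exact: fE.
rewrite derive1_cst => /(_ _ _)/esym H.
suff : (\int[lam]_x pd k F x)%R = 0.
  by move=> I0'; rewrite -[LHS]fineK ?integrable_fin_num// -/(Rintegral _ _ _) I0'.
rewrite -[RHS]H.
- by apply: eq_Rintegral => x _; rewrite partE scale0r addr0.
- by move=> x; rewrite mulr_ge0.
- by move=> h x /I1 h1 _; rewrite partE; exact: bnd.
Qed.

End euclidean_divergence.

(** * Integration against a density *)

Section integral_density.
Local Open Scope ereal_scope.
Context d1 d2 (X : measurableType d1) (Y : measurableType d2) (R : realType).
Variables (mu : {measure set X -> \bar R}) (nu : {measure set Y -> \bar R}).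
Variables (D : set X) (D' : set Y) (mD : measurable D) (mD' : measurable D').
Variables (psi : Y -> X) (r : Y -> R).
Hypotheses (mpsi : measurable_fun D' psi) (psiD : forall y, D' y -> D (psi y)).
Hypotheses (mr : measurable_fun D' r) (r0 : forall y, D' y -> (0 <= r y)%R).
Hypothesis muE : forall A, measurable A -> A `<=` D ->
  mu A = \int[nu]_(y in D') (\1_A (psi y) * r y)%:E.

Import HBNNSimple.

(** [muE] is the case of indicators; it extends to simple functions by linearity and to nonnegative
    measurable functions by monotone convergence. The domains [D] and [D'] are kept explicit because
    chart maps are meaningful only there. *)
Lemma integral_density (e : X -> \bar R) : measurable_fun D e ->
  (forall x, D x -> 0 <= e x) ->
  \int[mu]_(x in D) e x = \int[nu]_(y in D') (e (psi y) * (r y)%:E).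
Proof.
move=> me e0; pose f_ := nnsfun_approx mD me.
have mpsi1 (A : set X) : measurable A -> measurable_fun D' (fun y => \1_A (psi y) : R).
  by move=> mA; apply: (measurable_comp (F := setT)).
transitivity (limn (fun n => \int[mu]_(x in D) (f_ n x)%:E)).
  rewrite -monotone_convergence//.
  - apply: eq_integral => y /[!inE] yD; apply/esym/cvg_lim => //.
    exact: cvg_nnsfun_approx.
  - by move=> n; exact/measurable_EFinP/measurable_funTS.
  - by move=> n y _; rewrite lee_fin.
  - by move=> y _ m n mn; rewrite lee_fin; exact/lefP/nd_nnsfun_approx.
have mfpsi n : measurable_fun D' (fun y => f_ n (psi y)).
  by apply: (measurable_comp (F := setT)).
transitivity (limn (fun n => \int[nu]_(y in D') (f_ n (psi y) * r y)%:E)); last first.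
  rewrite -monotone_convergence//.
  - apply: eq_integral => y /[!inE] yD; apply/cvg_lim => //.
    under eq_fun do rewrite EFinM.
    by apply: cvgeZr => //; apply: cvg_nnsfun_approx => //; exact: psiD.
  - by move=> n; apply/measurable_EFinP; exact: measurable_funM.
  - by move=> n y Dy; rewrite lee_fin mulr_ge0// r0.
  - move=> y Dy m n mn; rewrite lee_fin ler_wpM2r ?r0//.
    exact/lefP/nd_nnsfun_approx.
congr (limn _); apply/funext => n.
have mf r' : measurable (f_ n @^-1` [set r']).
  by rewrite -[X in measurable X]setTI; exact: measurable_funP.
transitivity (\sum_(k \in range (f_ n))
    k%:E * \int[mu]_(x in D) (\1_(f_ n @^-1` [set k]) x)%:E).
  under eq_integral do rewrite fimfunE -fsumEFin//.
  rewrite ge0_integral_fsum//; last 2 first.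
  - by move=> y; apply/measurable_EFinP/measurable_funM => //; exact: measurable_indic.
  - by move=> y x _; rewrite nnfun_muleindic_ge0.
  by apply: eq_fsbigr => k _; rewrite integralZl_indic_nnsfun.
transitivity (\sum_(k \in range (f_ n))
    \int[nu]_(y in D') (k%:E * (\1_(f_ n @^-1` [set k]) (psi y) * r y)%:E)).
  apply: eq_fsbigr => k /[!inE] -[x _ fxk].
  rewrite ge0_integralZl_EFin//; last 3 first.
  - by move=> y Dy; rewrite lee_fin mulr_ge0// r0.
  - by apply/measurable_EFinP/measurable_funM => //; exact: mpsi1.
  - by rewrite -fxk.
  congr (_ * _); rewrite integral_indic// muE//; last exact: measurableI.
  apply: eq_integral => y /[!inE] Dy; rewrite !indicE in_setI.
  by rewrite (mem_set (psiD Dy)) andbT.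
rewrite -ge0_integral_fsum//.
- apply: eq_integral => y _; rewrite [in RHS]fimfunE EFinM -fsumEFin// ge0_mule_fsuml.
    by apply: eq_fsbigr => k _; rewrite -!EFinM mulrA.
  by move=> k; rewrite nnfun_muleindic_ge0.
- move=> k; apply: measurable_funeM; apply/measurable_EFinP/measurable_funM => //.
  exact: mpsi1.
- move=> k y Dy; rewrite -EFinM mulrA EFinM mule_ge0//; last by rewrite lee_fin r0.
  exact: nnfun_muleindic_ge0.
Qed.

End integral_density.

(** * Determinants and Jacobi's formula *)

(* The determinant does not vanish on the segment from the identity to [G]. *)
Lemma posdef_det_gt0 (R : rcfType) n (G : 'M[R]_n) :
  (forall w : 'rV[R]_n, w != 0 -> 0 < (w *m G *m w^T) 0 0) -> 0 < \det G.
Proof.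
move=> Gpos.
have sq_ge0 (w : 'rV[R]_n) : 0 <= (w *m w^T) 0 0.
  by rewrite mxE sumr_ge0// => i _; rewrite mxE -expr2 sqr_ge0.
have sq_gt0 (w : 'rV[R]_n) : w != 0 -> 0 < (w *m w^T) 0 0.
  move=> w0; rewrite lt_neqAle sq_ge0 andbT eq_sym; apply: contra w0.
  rewrite mxE psumr_eq0; last by move=> i _; rewrite mxE -expr2 sqr_ge0.
  move=> /allP w0; apply/eqP/rowP => i; rewrite mxE; apply/eqP.
  by have := w0 i (mem_index_enum i); rewrite mxE -expr2 sqrf_eq0.
(* Along the segment the determinant is a polynomial in the parameter, so the intermediate value
   theorem for polynomials applies. *)
pose P := \det ((1 - 'X) *: 1%:M + 'X *: map_mx polyC G) : {poly R}.
have PE t : P.[t] = \det ((1 - t) *: 1%:M + t *: G).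
  rewrite -[LHS]horner_evalE -det_map_mx; congr (\det _).
  apply/matrixP => i j; rewrite !mxE /= horner_evalE !hornerE.
  by case: (i == j); rewrite ?hornerE.
(* A kernel vector [w] would annihilate (1 - t) w w^T + t w G w^T, a sum of nonnegative terms that
   are not both zero. *)
have Pn0 t : 0 <= t <= 1 -> P.[t] != 0.
  move=> /andP[t0 t1]; rewrite PE; apply/negP => /det0P[w w0].
  move=> /(congr1 (fun z => (z *m w^T) 0 0)).
  rewrite mul0mx mulmxDr mulmxDl -!scalemxAr mulmx1 -!scalemxAl.
  move: (sq_gt0 w w0) (Gpos w w0); move: (w *m w^T) (w *m G *m w^T) => a b W H.
  rewrite !mxE => E.
  have [t00|t00] := eqVneq t 0.
    by move: E; rewrite t00 subr0 mul1r mul0r addr0 => E; rewrite E ltxx in W.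
  have tpos : 0 < t by rewrite lt_neqAle eq_sym t00.
  have := mulr_gt0 tpos H; have : 0 <= 1 - t by rewrite subr_ge0.
  by move=> /mulr_ge0 /(_ (ltW W)) A B; have := ltr_wpDl A B; rewrite E ltxx.
have P0 : P.[0] = 1 by rewrite PE subr0 scale1r scale0r addr0 det1.
have P1 : P.[1] = \det G by rewrite PE subrr scale0r scale1r add0r.
rewrite ltNge -P1; apply/negP => P10.
have [||t t01] := @poly_ivt R (- P) 0 1.
- exact: ler01.
- by rewrite !hornerE P0 oppr_le0 ler01 oppr_ge0.
- by rewrite rootN /root; apply/negP; exact: Pn0.
Qed.

Section jacobi.
Variables (R : realType) (n : nat).
Notation V := 'rV[R]_n.

Lemma pd_prod (I : eqType) (r : seq I) (F : I -> V -> R) (x : V) (i : 'I_n) : uniq r ->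
  (forall j, differentiable (F j) x) ->
  differentiable (fun y => \prod_(j <- r) F j y) x /\
  pd i (fun y => \prod_(j <- r) F j y) x =
  \sum_(j <- r) pd i (F j) x * \prod_(l <- r | l != j) F l x.
Proof.
move=> ur dF; elim: r ur => [_|j r IH /= /andP[jr ur]].
  rewrite (_ : (fun _ => _) = cst 1); last by apply/funext => y; rewrite big_nil.
  by split; [exact: differentiable_cst|rewrite big_nil [LHS]pd_cst].
have [dP pP] := IH ur.
rewrite (_ : (fun _ => _) = (fun y => F j y * \prod_(l <- r) F l y)); last first.
  by apply/funext => y; rewrite big_cons.
split; first exact: (@differentiableM _ _ (F j)).
rewrite (pdM i (dF j) dP) pP !big_cons eqxx /=; congr (_ * _ + _).
  rewrite [RHS]big_seq_cond [LHS]big_seq; apply: eq_bigl => l.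
  by case: (boolP (l \in r)) => //= lr; apply/esym; apply: contraNneq jr => <-.
rewrite mulr_sumr; apply: eq_big_seq => l lr.
rewrite big_cons ifT; first by rewrite mulrCA.
by apply: contraNneq jr => ->.
Qed.

Lemma pd_det m (G : V -> 'M[R]_m) (x : V) (i : 'I_n) :
  (forall k l, differentiable (fun y => G y k l) x) ->
  pd i (fun y => \det (G y)) x =
  \sum_k \sum_l pd i (fun y => G y k l) x * cofactor (G x) k l.
Proof.
move=> dG; pose F (s : {perm 'I_m}) (y : V) : R := \prod_(k < m) G y k (s k).
have dF s : differentiable (F s) x /\ pd i (F s) x =
    \sum_k pd i (fun y => G y k (s k)) x * \prod_(l | l != k) G x l (s l).
  by apply: (@pd_prod _ (index_enum 'I_m) (fun k y => G y k (s k))) => //; exact: index_enum_uniq.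
rewrite /determinant pd_sum; last first.
  by move=> s; apply: (@differentiableM _ _ (cst ((-1) ^+ s)) (F s)) => //; exact: (dF s).1.
transitivity (\sum_(s : {perm 'I_m}) \sum_k (-1) ^+ s *
    (pd i (fun y => G y k (s k)) x * \prod_(l | l != k) G x l (s l))).
  apply: eq_bigr => s _; rewrite -mulr_sumr -(dF s).2.
  by rewrite (@pdMl _ _ _ i ((-1) ^+ s) (F s) (dF s).1).
rewrite exchange_big /=; apply: eq_bigr => k _.
(* [A] is [G x] with row [k] differentiated: the sum over permutations is its determinant, and
   expansion along that row yields cofactors of [G x]. *)
pose A : 'M[R]_m := \matrix_(a, b) if a == k then pd i (fun y => G y k b) x else G x a b.
transitivity (\det A).
  apply: eq_bigr => s _; congr (_ * _); rewrite [RHS](bigD1 k)//= !mxE eqxx; congr (_ * _).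
  by apply: eq_bigr => l lk; rewrite mxE (negbTE lk).
rewrite (expand_det_row A k); apply: eq_bigr => l _; rewrite mxE eqxx; congr (_ * _).
rewrite /cofactor; congr (_ * \det _); apply/matrixP => a b.
by rewrite !mxE eq_sym (negbTE (neq_lift _ _)).
Qed.

Lemma C1on_det (U : set V) m (G : V -> 'M[R]_m) : open U ->
  (forall k l, C1on U (fun y => G y k l)) -> C1on U (fun y => \det (G y)).
Proof.
move=> oU GC; rewrite /determinant; apply: C1on_sum => // s.
by apply: C1onM => //; [exact: C1on_cst|exact: C1on_prod].
Qed.

(** By the adjugate formula the entries are cofactors divided by the determinant. *)
Lemma C1on_invmx (U : set V) m (G : V -> 'M[R]_m) : open U ->
  (forall k l, C1on U (fun y => G y k l)) -> (forall y, U y -> \det (G y) != 0) ->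
  forall k l, C1on U (fun y => invmx (G y) k l).
Proof.
move=> oU GC G0 k l.
apply: (@eq_C1on _ _ U (fun y => (\det (G y))^-1 * cofactor (G y) l k)) => //.
  by move=> y Uy; rewrite /invmx unitmxE unitfE G0// !mxE.
apply: C1onM => //; first by apply: C1onV => //; exact: C1on_det.
apply: C1onM => //; first exact: C1on_cst.
apply: C1on_det => // a b; apply: (eq_C1on oU _ (GC (lift l a) (lift k b))) => y _.
by rewrite !mxE.
Qed.

End jacobi.

(** * Index computations with the Levi-Civita connection *)

Section christoffel_algebra.
(* At one point of a chart: [dG i a b], [dU k i] and [dS i k j] stand for
   d_i g_ab, d_i U^k and d_i S^kj, [lie U dU a b] for (L_U g)_ab, [CL U dU a i]
   for U_{a;i}. *)
Variables (F : realFieldType) (n : nat).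
Variables (G Gi : 'I_n -> 'I_n -> F) (dG : 'I_n -> 'I_n -> 'I_n -> F).
Hypotheses (Gsym : forall a b, G a b = G b a) (Gisym : forall a b, Gi a b = Gi b a).
Hypothesis dGsym : forall i a b, dG i a b = dG i b a.
Hypothesis GGi : forall a c, \sum_b G a b * Gi b c = (a == c)%:R.

Let Gamma k i j :=
  2^-1 * \sum_l Gi k l * (dG i j l + dG j i l - dG l i j).
Let cov (U : 'I_n -> F) (dU : 'I_n -> 'I_n -> F) k i :=
  dU k i + \sum_j Gamma k i j * U j.
Let strn U dU k j := \sum_i Gi k i * cov U dU j i + \sum_i Gi i j * cov U dU k i.
Let lie (U : 'I_n -> F) (dU : 'I_n -> 'I_n -> F) a b :=
  \sum_m (U m * dG m a b + G m b * dU m a + G a m * dU m b).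
Let CL U dU a i := \sum_b G a b * cov U dU b i.

Lemma sum_delta (X : 'I_n -> F) a : \sum_c (a == c)%:R * X c = X a.
Proof.
rewrite (bigD1 a)//= eqxx mul1r big1 ?addr0// => c ca.
by rewrite eq_sym (negbTE ca) mul0r.
Qed.

Lemma contract_GGi (X : 'I_n -> F) a : \sum_b G a b * (\sum_c Gi b c * X c) = X a.
Proof.
under eq_bigr do rewrite mulr_sumr.
rewrite exchange_big/= -[RHS]sum_delta; apply: eq_bigr => c _.
by rewrite -GGi mulr_suml; apply: eq_bigr => b _; rewrite mulrA.
Qed.

Lemma GiG a c : \sum_b Gi a b * G b c = (a == c)%:R.
Proof.
have : (\matrix_(i, j) G i j) *m (\matrix_(i, j) Gi i j) = 1%:M.
  apply/matrixP => i j; rewrite !mxE -GGi.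
  by apply: eq_bigr => k _; rewrite !mxE.
move=> /mulmx1C /matrixP /(_ a c); rewrite !mxE => <-.
by apply: eq_bigr => k _; rewrite !mxE.
Qed.

Lemma contract_GiG (X : 'I_n -> F) a : \sum_b Gi a b * (\sum_c G b c * X c) = X a.
Proof.
under eq_bigr do rewrite mulr_sumr.
rewrite exchange_big/= -[RHS]sum_delta; apply: eq_bigr => c _.
by rewrite -GiG mulr_suml; apply: eq_bigr => b _; rewrite mulrA.
Qed.

(** Lowering the upper index cancels the inverse metric and leaves the Christoffel symbols of the
    first kind. *)
Lemma lower_Gamma a i j :
  \sum_b G a b * Gamma b i j = 2^-1 * (dG i j a + dG j i a - dG a i j).
Proof.
rewrite -[in RHS](contract_GGi (fun a => dG i j a + dG j i a - dG a i j)) mulr_sumr.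
by apply: eq_bigr => b _; rewrite mulrCA.
Qed.

Lemma CLE U dU a i : CL U dU a i = \sum_b G a b * dU b i +
  \sum_j 2^-1 * (dG i j a + dG j i a - dG a i j) * U j.
Proof.
rewrite /CL /cov; under eq_bigr do rewrite mulrDr.
rewrite big_split/=; congr (_ + _).
under eq_bigr do rewrite mulr_sumr.
rewrite exchange_big/=; apply: eq_bigr => j _; rewrite -lower_Gamma mulr_suml.
by apply: eq_bigr => b _; rewrite mulrA.
Qed.

(** In U_{a;b} + U_{b;a} the terms with d_a g and d_b g cancel by symmetry of the metric, and the
    two halves of U^m d_m g_ab add up. *)
Lemma lieE U dU a b : lie U dU a b = CL U dU a b + CL U dU b a.
Proof.
rewrite !CLE addrACA -!big_split/=.
apply: eq_bigr => m _.
rewrite (Gsym m b) (dGsym b m a) (dGsym a m b) (dGsym m b a).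
by field.
Qed.

Lemma lower_strn U dU a b :
  \sum_k G a k * (\sum_j G b j * strn U dU k j) = lie U dU a b.
Proof.
have E k : \sum_j G b j * strn U dU k j = \sum_i Gi k i * CL U dU b i + cov U dU k b.
  rewrite /strn; under eq_bigr do rewrite mulrDr.
  rewrite big_split/=; congr (_ + _).
    rewrite /CL; under eq_bigr do rewrite mulr_sumr.
    rewrite exchange_big/=; apply: eq_bigr => i _; rewrite mulr_sumr.
    by apply: eq_bigr => j _; rewrite mulrCA.
  rewrite -[RHS](contract_GGi (fun b => cov U dU k b)).
  apply: eq_bigr => j _; congr (_ * _); apply: eq_bigr => i _.
  by rewrite Gisym.
under eq_bigr do rewrite E mulrDr.
by rewrite big_split/= contract_GGi lieE addrC.
Qed.

Lemma strnE U dU k j :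
  strn U dU k j = \sum_a Gi k a * (\sum_b Gi j b * lie U dU a b).
Proof.
rewrite -[LHS](contract_GiG (fun k => strn U dU k j) k).
apply: eq_bigr => a _; congr (_ * _).
rewrite -[LHS](contract_GiG (fun j => \sum_k G a k * strn U dU k j) j).
apply: eq_bigr => b _; congr (_ * _); rewrite -lower_strn.
under eq_bigr do rewrite mulr_sumr.
rewrite exchange_big/=; apply: eq_bigr => c _; rewrite mulr_sumr.
by apply: eq_bigr => d _; rewrite mulrCA.
Qed.

Lemma strn_sym U dU k j : strn U dU k j = strn U dU j k.
Proof.
rewrite /strn addrC; congr (_ + _); apply: eq_bigr => i _; by rewrite Gisym.
Qed.

(** With chi_k = d_k f this reads S^kj v_j d_k f = (L_U g)(grad f, v). The strain is L_U g with both
    indices raised, so the connection disappears from the pairing. *)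
Lemma strn_pair U dU (v chi : 'I_n -> F) :
  \sum_k (\sum_j strn U dU k j * (\sum_l G j l * v l)) * chi k =
  \sum_a \sum_b (\sum_k Gi a k * chi k) * v b * lie U dU a b.
Proof.
have E k : \sum_j strn U dU k j * (\sum_l G j l * v l) =
    \sum_a Gi k a * (\sum_b v b * lie U dU a b).
  under eq_bigr do rewrite strnE mulr_suml.
  rewrite exchange_big/=; apply: eq_bigr => a _.
  under eq_bigr do rewrite -mulrA mulr_suml.
  rewrite -mulr_sumr; congr (_ * _); rewrite exchange_big/=.
  apply: eq_bigr => b _; rewrite -[v b](contract_GiG v b) mulr_suml.
  by apply: eq_bigr => j _; rewrite (Gisym j b); ring.
under eq_bigr do rewrite E mulr_suml.
rewrite exchange_big/=; apply: eq_bigr => a _.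
under [RHS]eq_bigr do rewrite -mulrA.
rewrite -mulr_sumr mulr_suml.
by apply: eq_bigr => k _; rewrite (Gisym k a); ring.
Qed.

(** * Consequences of the Killing equation at a point *)

Section killing_field.
Variables (v : 'I_n -> F) (dv : 'I_n -> 'I_n -> F).
Hypothesis v_killing : forall k j, strn v dv k j = 0.

Let w a := \sum_l G a l * v l.
Let dw a k := \sum_l (dG k a l * v l + G a l * dv l k).
(* w_{a;k}, which is antisymmetric because [v] is Killing. *)
Let K a k := dw a k - \sum_l Gamma l k a * w l.

(** Metric compatibility of the connection: lowering an index commutes with covariant
    differentiation. *)
Lemma KE a k : K a k = CL v dv a k.
Proof.
rewrite CLE /K /dw.
have -> : \sum_l Gamma l k a * w l =
    \sum_l 2^-1 * (dG k a l + dG a k l - dG l k a) * v l.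
  rewrite /w; under eq_bigr do rewrite mulr_sumr.
  rewrite exchange_big/=; apply: eq_bigr => l _.
  rewrite -lower_Gamma mulr_suml; apply: eq_bigr => m _.
  by rewrite (Gsym m l); ring.
rewrite big_split/= addrAC -sumrB addrC; congr (_ + _).
apply: eq_bigr => l _; rewrite (dGsym k l a) (dGsym l k a); by field.
Qed.

Lemma K_antisym a k : K a k = - K k a.
Proof.
apply/eqP; rewrite -addr_eq0 !KE -lieE -lower_strn big1// => i _.
by rewrite big1 ?mulr0// => j _; rewrite v_killing mulr0.
Qed.

Lemma sum_antisym (X : 'I_n -> 'I_n -> F) : (forall a k, X a k = X k a) ->
  \sum_a \sum_k X a k * K a k = 0.
Proof.
move=> Xs; set s := LHS; have : s = - s.
  rewrite {1}/s exchange_big/= /s -sumrN; apply: eq_bigr => a _.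
  rewrite -sumrN; apply: eq_bigr => k _.
  by rewrite K_antisym Xs mulrN.
by move=> ss; apply/eqP; move/eqP: ss; rewrite -addr_eq0 -mulr2n mulrn_eq0.
Qed.

(** The divergence is g^ia v_{a;i}, a symmetric tensor contracted with an antisymmetric one. *)
Lemma killing_div0 : \sum_i cov v dv i i = 0.
Proof.
have E i : cov v dv i i = \sum_a Gi i a * K a i.
  rewrite -[LHS](contract_GiG (fun b => cov v dv b i) i).
  by apply: eq_bigr => a _; rewrite KE.
under eq_bigr do rewrite E.
by rewrite exchange_big/=; apply: sum_antisym => a k; rewrite Gisym.
Qed.

Let Gam k := \sum_i Gamma i i k.

Lemma div_cov U dU : \sum_i cov U dU i i = \sum_k (dU k k + Gam k * U k).
Proof.
rewrite /cov !big_split/=; congr (_ + _); rewrite exchange_big/=.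
by apply: eq_bigr => k _; rewrite mulr_suml.
Qed.

(** Contracted with the symmetric [Gi], the other two derivative terms of the Christoffel symbol
    cancel. By Jacobi's formula the right side is the logarithmic derivative of sqrt(det g), as used
    in [pd_vol]. *)
Lemma contracted_christoffelE k : Gam k = 2^-1 * \sum_i \sum_l Gi i l * dG k i l.
Proof.
rewrite /Gam /Gamma -mulr_sumr; congr (_ * _).
have E : \sum_i \sum_l Gi i l * (dG k i l - dG l i k) + \sum_i \sum_l Gi i l * dG i k l =
   \sum_i \sum_l Gi i l * dG k i l.
  have -> : \sum_i \sum_l Gi i l * dG i k l = \sum_i \sum_l Gi i l * dG l i k.
    rewrite exchange_big/=; apply: eq_bigr => i _; apply: eq_bigr => l _.
    by rewrite (Gisym i l) (dGsym l i k).
  rewrite -big_split/=; apply: eq_bigr => i _; rewrite -big_split/=.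
  by apply: eq_bigr => l _; ring.
rewrite -[RHS]E -big_split/=; apply: eq_bigr => i _; rewrite -big_split/=.
by apply: eq_bigr => l _; ring.
Qed.

Variables (mu : F) (U : 'I_n -> F) (dU : 'I_n -> 'I_n -> F).
Hypothesis U_div0 : \sum_i cov U dU i i = 0.
Variables (p : F) (dp : 'I_n -> F) (dS : 'I_n -> 'I_n -> 'I_n -> F).
Let S := strn U dU.
Let theta := \sum_k U k * w k.
Let dtheta i := \sum_k (dU k i * w k + U k * dw k i).

(** div(theta U) = theta div U + U^k d_k theta, where div U = 0. Expanding theta = U^j w_j gives U^k
    U^j_{;k} w_j + U^j U^k w_{j;k}, whose last term vanishes by antisymmetry. *)
Lemma advection_div :
  \sum_k ((dU k k * theta + U k * dtheta k) + Gam k * (U k * theta)) =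
  \sum_j (\sum_i cov U dU j i * U i) * w j.
Proof.
have -> : \sum_k ((dU k k * theta + U k * dtheta k) + Gam k * (U k * theta)) =
    (\sum_k (dU k k + Gam k * U k)) * theta + \sum_k U k * dtheta k.
  by rewrite mulr_suml -big_split/=; apply: eq_bigr => k _; ring.
rewrite -div_cov U_div0 mul0r add0r.
have -> : \sum_k U k * dtheta k =
    \sum_j \sum_k (U j * U k * K j k + (dU j k * w j * U k +
      \sum_l Gamma l k j * w l * (U j * U k))).
  rewrite /dtheta; under eq_bigr do rewrite mulr_sumr.
  rewrite exchange_big /=; apply: eq_bigr => j _; apply: eq_bigr => k _.
  rewrite /K mulrBr -mulr_suml; ring.
under eq_bigr do rewrite big_split/=.
rewrite big_split/= sum_antisym ?add0r; last by move=> a k; rewrite [U a * _]mulrC.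
under eq_bigr do rewrite big_split/=.
rewrite big_split/= /cov.
under [RHS]eq_bigr => j _.
  under eq_bigr do rewrite mulrDl.
  rewrite big_split/= mulrDl.
  over.
rewrite big_split/=; congr (_ + _).
  by apply: eq_bigr => j _; rewrite mulr_suml; apply: eq_bigr => k _; ring.
under [RHS]eq_bigr do rewrite mulr_suml.
rewrite exchange_big/= [RHS]exchange_big/=; apply: eq_bigr => k _.
rewrite exchange_big/=; apply: eq_bigr => l _.
rewrite !mulr_suml; apply: eq_bigr => j _; ring.
Qed.

(** The product rule gives (S^kj w_j)_{;k} = S^kj_{;k} w_j + S^kj w_{j;k}, and the last term
    vanishes because S is symmetric. *)
Lemma diffusion_div :
  \sum_k (\sum_j (dS k k j * w j + S k j * dw j k) + Gam k * (\sum_j S k j * w j)) =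
  \sum_j (\sum_k (dS k k j + \sum_l Gamma k k l * S l j + \sum_l Gamma j k l * S k l)) * w j.
Proof.
have E1 : \sum_j \sum_k S k j * dw j k =
    \sum_j \sum_k \sum_l Gamma l k j * w l * S k j.
  have -> : \sum_j \sum_k S k j * dw j k =
      \sum_j \sum_k (S k j * K j k + \sum_l Gamma l k j * w l * S k j).
    apply: eq_bigr => j _; apply: eq_bigr => k _.
    by rewrite /K mulrBr -mulr_suml; ring.
  under eq_bigr do rewrite big_split/=.
  by rewrite big_split/= sum_antisym ?add0r// => a k; exact: strn_sym.
have -> : \sum_k (\sum_j (dS k k j * w j + S k j * dw j k) + Gam k * (\sum_j S k j * w j)) =
    \sum_k \sum_j dS k k j * w j + \sum_j \sum_k S k j * dw j k +
    \sum_k \sum_j Gam k * (S k j * w j).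
  rewrite [X in _ + X + _]exchange_big/= -!big_split/=; apply: eq_bigr => k _.
  by rewrite big_split/= mulr_sumr.
rewrite E1.
have -> : \sum_j (\sum_k (dS k k j + \sum_l Gamma k k l * S l j + \sum_l Gamma j k l * S k l)) * w j =
   \sum_j \sum_k dS k k j * w j + \sum_j \sum_k \sum_l Gamma k k l * S l j * w j +
   \sum_j \sum_k \sum_l Gamma j k l * S k l * w j.
  rewrite -!big_split/=; apply: eq_bigr => j _; rewrite mulr_suml -!big_split/=.
  by apply: eq_bigr => k _; rewrite !mulrDl !mulr_suml.
rewrite addrAC; congr (_ + _ + _).
- by rewrite exchange_big.
- rewrite exchange_big/=; apply: eq_bigr => j _; rewrite exchange_big/=.
  apply: eq_bigr => l _; rewrite /Gam mulr_suml; apply: eq_bigr => k _; ring.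
- rewrite exchange_big/=; under eq_bigr do rewrite exchange_big/=.
  rewrite exchange_big/=; apply: eq_bigr => l _; apply: eq_bigr => k _.
  apply: eq_bigr => j _; ring.
Qed.

(** As div v = 0, only v^k d_k p survives from div(p v), and this is g(grad p, v). *)
Lemma gradient_div :
  \sum_k ((dp k * v k + p * dv k k) + Gam k * (p * v k)) =
  \sum_j (\sum_k Gi j k * dp k) * w j.
Proof.
have -> : \sum_k ((dp k * v k + p * dv k k) + Gam k * (p * v k)) =
    p * (\sum_k (dv k k + Gam k * v k)) + \sum_k dp k * v k.
  by rewrite mulr_sumr -big_split/=; apply: eq_bigr => k _; ring.
rewrite -div_cov killing_div0 mulr0 add0r.
under [RHS]eq_bigr do rewrite mulr_suml.
rewrite exchange_big/=; apply: eq_bigr => k _.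
rewrite -{1}[v k](contract_GiG v k) mulr_sumr; apply: eq_bigr => j _.
by rewrite (Gisym k j) /w; ring.
Qed.

End killing_field.
End christoffel_algebra.

(** * The flux in a chart *)

Section charts.
Variables (R : realType) (n : nat) (M : topologicalType) (A : smooth_atlas R n M).
Variable g : riemannian_metric A.
Implicit Types (c : chart A) (u v : components A).

Lemma cimg_open c : open (cimg c).
Proof. exact: open_cimg. Qed.
Hint Resolve cimg_open : core.
Arguments cimg_open : clear implicits.

Lemma cimg_coord c m : cdom c m -> cimg c (coord c m).
Proof. by move=> cm; exists m. Qed.

Lemma cdom_param c x : cimg c x -> cdom c (param c x).
Proof. by move=> [m cm <-]; rewrite coordK. Qed.

Lemma paramK c x : cimg c x -> coord c (param c x) = x.
Proof. by move=> [m cm <-]; rewrite coordK. Qed.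

Lemma metric_C2 c i j : C2on (cimg c) (fun x => g c x i j).
Proof. by apply: smooth_C2on => //; exact: metric_smooth. Qed.

Lemma metric_C1 c i j : C1on (cimg c) (fun x => g c x i j).
Proof. exact: (metric_C2 c i j).1. Qed.
Arguments metric_C1 : clear implicits.

Lemma dmetric_C1 c i j k : C1on (cimg c) (pd k (fun x => g c x i j)).
Proof. exact: (metric_C2 c i j).2. Qed.

Lemma metric_symE c x i j : cimg c x -> g c x i j = g c x j i.
Proof. by move=> cx; have /matrixP/(_ j i) := metric_sym g cx; rewrite mxE. Qed.

Lemma pd_metric_sym c x k i j : cimg c x ->
  pd k (fun y => g c y i j) x = pd k (fun y => g c y j i) x.
Proof.
move=> cx; apply: near_eq_pd; near=> y; apply: metric_symE; near: y.
exact: open_nbhs_nbhs.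
Unshelve. all: by end_near. Qed.

Lemma det_metric_gt0 c x : cimg c x -> 0 < \det (g c x).
Proof. by move=> cx; apply: posdef_det_gt0 => w; exact: metric_pos. Qed.

Lemma metric_unit c x : cimg c x -> g c x \in unitmx.
Proof. by move=> /det_metric_gt0 d0; rewrite unitmxE unitfE gt_eqF. Qed.

Lemma metric_ginv c x : cimg c x ->
  forall a b, \sum_l g c x a l * ginv g c x l b = (a == b)%:R.
Proof.
move=> /metric_unit gu a b.
by have /matrixP/(_ a b) := mulmxV gu; rewrite !mxE.
Qed.

Lemma ginv_sym c x a b : cimg c x -> ginv g c x a b = ginv g c x b a.
Proof. by move=> cx; rewrite /ginv -[in LHS](metric_sym g cx) -trmx_inv mxE. Qed.

Lemma ginv_C1 c k l : C1on (cimg c) (fun x => ginv g c x k l).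
Proof.
apply: C1on_invmx => // [a b|x cx]; first exact: metric_C1.
by rewrite gt_eqF// det_metric_gt0.
Qed.

Lemma christoffel_C1 c k i j : C1on (cimg c) (christoffel g c k i j).
Proof.
apply: C1onM => //; first exact: C1on_cst.
apply: C1on_sum => // l; apply: C1onM => //; first exact: ginv_C1.
by apply: C1onB => //; [apply: C1onD => //|]; exact: dmetric_C1.
Qed.

Definition vol c (x : 'rV[R]_n) : R := Num.sqrt (\det (g c x)).

Lemma vol_gt0 c x : cimg c x -> 0 < vol c x.
Proof. by move=> cx; rewrite sqrtr_gt0 det_metric_gt0. Qed.

Lemma vol_C1 c : C1on (cimg c) (vol c).
Proof.
apply: (C1on_sqrt _ (fun y cy => det_metric_gt0 cy) _).1 => //.
by apply: C1on_det => // k l; exact: metric_C1.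
Qed.

(** Jacobi's formula combined with [contracted_christoffelE]. It lets the weight sqrt(det g) turn a
    coordinate divergence into the Riemannian one. *)
Lemma pd_vol c x k : cimg c x ->
  pd k (vol c) x = vol c x * \sum_i christoffel g c i i k x.
Proof.
move=> cx.
have detC := C1on_det (cimg_open c) (metric_C1 c).
rewrite ((C1on_sqrt (cimg_open c) (fun y cy => det_metric_gt0 cy) detC).2 x k cx).
rewrite pd_det; last by move=> a b; exact: C1on_diff (metric_C1 c a b) cx.
have cofE a b : cofactor (g c x) a b = \det (g c x) * ginv g c x a b.
  rewrite -ginv_sym// /ginv /invmx metric_unit// !mxE mulrA mulfV ?mul1r//.
  by rewrite gt_eqF// det_metric_gt0.
have -> : \sum_a \sum_b pd k (fun y => g c y a b) x * cofactor (g c x) a b =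
   \det (g c x) * \sum_a \sum_b ginv g c x a b * pd k (fun y => g c y a b) x.
  rewrite mulr_sumr; apply: eq_bigr => a _; rewrite mulr_sumr.
  by apply: eq_bigr => b _; rewrite cofE; ring.
rewrite [X in _ = _ * X](@contracted_christoffelE R n (fun a b => ginv g c x a b)
  (fun i a b => pd i (fun y => g c y a b) x)); last 2 first.
- by move=> a b; exact: ginv_sym.
- by move=> i a b; exact: pd_metric_sym.
have /eqP := sqr_sqrtr (ltW (det_metric_gt0 cx)); rewrite -/(vol c x) => /eqP <-.
have v0 : vol c x != 0 by rewrite gt_eqF// vol_gt0.
by field.
Qed.

Definition C1comp c u := forall k, C1on (cimg c) (fun x => u c x 0 k).
Definition C2comp c u := forall k, C2on (cimg c) (fun x => u c x 0 k).

Lemma covd_C1 c u k i : C2comp c u -> C1on (cimg c) (covd g u c k i).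
Proof.
move=> uC; apply: C1onD => //; first exact: (uC k).2.
by apply: C1on_sum => // j; apply: C1onM => //; [exact: christoffel_C1|exact: (uC j).1].
Qed.

Lemma strain_C1 c u k j : C2comp c u -> C1on (cimg c) (strain g u c k j).
Proof.
move=> uC; apply: C1onD => //; apply: C1on_sum => // i; apply: C1onM => //;
  by [exact: ginv_C1|exact: covd_C1].
Qed.

Definition lower v c (j : 'I_n) (x : 'rV[R]_n) : R := \sum_l g c x j l * v c x 0 l.
Definition dotc u v c (x : 'rV[R]_n) : R := \sum_k u c x 0 k * lower v c k x.

Lemma lower_C1 c v j : C1comp c v -> C1on (cimg c) (lower v c j).
Proof. by move=> vC; apply: C1on_sum => // l; apply: C1onM => //; exact: metric_C1. Qed.

Lemma dotc_C1 c u v : C1comp c u -> C1comp c v -> C1on (cimg c) (dotc u v c).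
Proof.
move=> uC vC; have oc := cimg_open c.
by apply: (C1on_sum _ oc) => l; exact: C1onM oc (uC l) (lower_C1 l vC).
Qed.

(* W^k = u^k g(u, v) - mu S^kj v_j + p v^k, whose divergence is -g(u_t, v). *)
Definition flux (mu : R) u v (p : 'rV[R]_n -> R) c (k : 'I_n) (x : 'rV[R]_n) : R :=
  u c x 0 k * dotc u v c x - mu * (\sum_j strain g u c k j x * lower v c j x)
  + p x * v c x 0 k.

Lemma C2comp_C1 c u : C2comp c u -> C1comp c u.
Proof. by move=> uC k; exact: (uC k).1. Qed.

Lemma flux_C1 mu u v p c k : C2comp c u -> C1comp c v -> C1on (cimg c) p ->
  C1on (cimg c) (flux mu u v p c k).
Proof.
move=> uC2 vC pC; have uC := C2comp_C1 uC2; have oc := cimg_open c.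
have sC : C1on (cimg c) (fun x => \sum_j strain g u c k j x * lower v c j x).
  by apply: (C1on_sum _ oc) => j; exact: C1onM oc (strain_C1 k j uC2) (lower_C1 j vC).
have dC := C1onM oc (uC k) (dotc_C1 uC vC).
exact: C1onD oc (C1onB oc dC (C1onM oc (@C1on_cst R n _ mu) sC)) (C1onM oc pC (vC k)).
Qed.

Lemma pd_lower c v j k x : C1comp c v -> cimg c x -> pd k (lower v c j) x =
  \sum_l (pd k (fun y => g c y j l) x * v c x 0 l + g c x j l * pd k (fun y => v c y 0 l) x).
Proof.
move=> vC cx; rewrite pd_sum.
  by apply: eq_bigr => l _; rewrite pdM//; [exact: C1on_diff (metric_C1 c j l) cx|exact: C1on_diff (vC l) cx].
by move=> l; exact: C1on_diff (C1onM (cimg_open c) (metric_C1 c j l) (vC l)) cx.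
Qed.

Lemma pd_dotc c u v k x : C1comp c u -> C1comp c v -> cimg c x -> pd k (dotc u v c) x =
  \sum_j (pd k (fun y => u c y 0 j) x * lower v c j x + u c x 0 j * pd k (lower v c j) x).
Proof.
move=> uC vC cx; have lC j := @lower_C1 c v j vC; rewrite pd_sum.
  by apply: eq_bigr => l _; rewrite pdM//; [exact: C1on_diff (uC l) cx|exact: C1on_diff (lC l) cx].
by move=> l; exact: C1on_diff (C1onM (cimg_open c) (uC l) (lC l)) cx.
Qed.

(** The sum of [advection_div], [diffusion_div] and [gradient_div] for the arrays of derivatives at
    [x]. The momentum equation enters only afterwards, in [flux_div_force]. *)
Lemma flux_div mu u v p c x : C2comp c u -> C1comp c v -> C1on (cimg c) p -> cimg c x ->
  div g u c x = 0 -> (forall k j, strain g v c k j x = 0) ->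
  \sum_k (pd k (flux mu u v p c k) x +
          (\sum_i christoffel g c i i k x) * flux mu u v p c k x) =
  \sum_j (advection g u c j x - mu * diffusion g u c j x +
          \sum_k ginv g c x j k * pd k p x) * lower v c j x.
Proof.
move=> uC2 vC pC cx udiv vkill; have uC := C2comp_C1 uC2.
pose G a b := g c x a b; pose Gi a b := ginv g c x a b.
pose dG i a b := pd i (fun y => g c y a b) x.
pose U k := u c x 0 k; pose dU k i := pd i (fun y => u c y 0 k) x.
pose V k := v c x 0 k; pose dV k i := pd i (fun y => v c y 0 k) x.
have Gs a b : G a b = G b a by exact: metric_symE.
have Gis a b : Gi a b = Gi b a by exact: ginv_sym.
have dGs i a b : dG i a b = dG i b a by exact: pd_metric_sym.
have GGi : forall a b, \sum_l G a l * Gi l b = (a == b)%:R by exact: metric_ginv.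
have H1 := @advection_div R n G Gi dG Gs Gis dGs GGi V dV vkill U dU udiv.
have H2 := @diffusion_div R n G Gi dG Gs Gis dGs GGi V dV vkill U dU
  (fun i k j => pd i (strain g u c k j) x).
have H3 := @gradient_div R n G Gi dG Gs Gis dGs GGi V dV vkill (p x) (fun k => pd k p x).
have oc := cimg_open c.
have lC j := @lower_C1 c v j vC.
have dC := dotc_C1 uC vC.
have sC k j := @strain_C1 c u k j uC2.
have slC k j := C1onM oc (sC k j) (lC j).
have ssC k := @C1on_sum R n _ _ (index_enum 'I_n) _ oc (slC k).
have D f (fC : C1on (cimg c) f) : differentiable f x := C1on_diff fC cx.
have E k : pd k (flux mu u v p c k) x =
    (dU k k * dotc u v c x + U k * pd k (dotc u v c) x)
    - mu * (\sum_j (pd k (strain g u c k j) x * lower v c j x +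
                    strain g u c k j x * pd k (lower v c j) x))
    + (pd k p x * V k + p x * dV k k).
  rewrite /flux.
  have d1 : differentiable (fun y => u c y 0 k * dotc u v c y) x.
    exact: D (C1onM oc (uC k) dC).
  have d2 : differentiable (fun y => \sum_j strain g u c k j y * lower v c j y) x.
    exact: D.
  have d3 : differentiable (fun y => mu * \sum_j strain g u c k j y * lower v c j y) x.
    exact: D (C1onM oc (@C1on_cst R n _ mu) (ssC k)).
  have d4 : differentiable (fun y => p y * v c y 0 k) x.
    exact: D (C1onM oc pC (vC k)).
  have d5 : differentiable (fun y => u c y 0 k * dotc u v c y -
     mu * \sum_j strain g u c k j y * lower v c j y) x by exact: differentiableB.
  rewrite (pdD k d5 d4) (pdB k d1 d3) (pdMl k mu d2).
  rewrite (pdM k (D _ (uC k)) (D _ dC)) (pdM k (D _ pC) (D _ (vC k))).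
  congr (_ - _ * _ + _); rewrite pd_sum; last by move=> j; exact: D.
  by apply: eq_bigr => j _; rewrite (pdM k (D _ (sC k j)) (D _ (lC j))).
under eq_bigr do rewrite E.
have -> : \sum_j (advection g u c j x - mu * diffusion g u c j x +
      \sum_k ginv g c x j k * pd k p x) * lower v c j x =
    (\sum_j advection g u c j x * lower v c j x)
    - mu * (\sum_j diffusion g u c j x * lower v c j x)
    + \sum_j (\sum_k ginv g c x j k * pd k p x) * lower v c j x.
  by rewrite mulr_sumr -sumrB -big_split/=; apply: eq_bigr => j _; ring.
rewrite -[X in X - _ + _]H1 -[X in _ - _ * X + _]H2 -[X in _ + X]H3.
rewrite mulr_sumr -sumrB -big_split/=; apply: eq_bigr => k _.
have Ed : pd k (dotc u v c) x = \sum_j (dU j k * lower v c j x + U j *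
    \sum_l (dG k j l * V l + G j l * dV l k)).
  by rewrite pd_dotc//; apply: eq_bigr => j _; rewrite pd_lower.
have Es : \sum_j (pd k (strain g u c k j) x * lower v c j x +
      strain g u c k j x * pd k (lower v c j) x) =
    \sum_j (pd k (strain g u c k j) x * lower v c j x +
      strain g u c k j x * \sum_l (dG k j l * V l + G j l * dV l k)).
  by apply: eq_bigr => j _; rewrite pd_lower.
rewrite Ed Es /flux.
have regroup (a b d e f h q r : R) :
    a - q * b + d + r * (e - q * f + h) = a + r * e - q * (b + r * f) + (d + r * h).
  by ring.
exact: regroup.
Qed.

(** The product rule div(chi F) = chi div F + F(chi), multiplied by the density; differentiating
    [vol] produces the Christoffel term of the divergence. *)
Lemma pd_weighted_flux mu u v p (chi : 'rV[R]_n -> R) c x : C2comp c u -> C1comp c v ->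
  C1on (cimg c) p -> C1on (cimg c) chi -> cimg c x ->
  \sum_k pd k (fun y => vol c y * (chi y * flux mu u v p c k y)) x =
  vol c x * (chi x * (\sum_k (pd k (flux mu u v p c k) x +
                (\sum_i christoffel g c i i k x) * flux mu u v p c k x)) +
             \sum_k flux mu u v p c k x * pd k chi x).
Proof.
move=> uC2 vC pC chiC cx; have oc := cimg_open c.
rewrite mulr_sumr -big_split/= mulr_sumr; apply: eq_bigr => k _.
have fC := @flux_C1 mu u v p c k uC2 vC pC.
have dV := C1on_diff (@vol_C1 c) cx; have dchi := C1on_diff chiC cx.
have df := C1on_diff fC cx.
have dcf := C1on_diff (C1onM oc chiC fC) cx.
by rewrite (pdM k dV dcf) (pdM k dchi df) pd_vol//; ring.
Qed.

End charts.

(** * Changes of charts *)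

Section transition_algebra.
Variables (F : comNzRingType) (n : nat) (J : 'I_n -> 'I_n -> F).

Lemma bilinear_pullback (X Y : 'I_n -> F) (B : 'I_n -> 'I_n -> F) :
  \sum_i \sum_j X i * Y j * (\sum_a \sum_b J a i * J b j * B a b) =
  \sum_a \sum_b (\sum_i J a i * X i) * (\sum_j J b j * Y j) * B a b.
Proof.
have -> : \sum_i \sum_j X i * Y j * (\sum_a \sum_b J a i * J b j * B a b) =
    \sum_i \sum_j \sum_a \sum_b (J a i * X i) * (J b j * Y j) * B a b.
  apply: eq_bigr => i _; apply: eq_bigr => j _; rewrite mulr_sumr.
  apply: eq_bigr => a _; rewrite mulr_sumr; apply: eq_bigr => b _; ring.
under eq_bigr do rewrite exchange_big/=.
rewrite exchange_big/=; apply: eq_bigr => a _.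
under eq_bigr do rewrite exchange_big/=.
rewrite exchange_big/=; apply: eq_bigr => b _.
rewrite -mulrA mulr_suml; apply: eq_bigr => i _.
by rewrite mulr_suml mulr_sumr; apply: eq_bigr => j _; rewrite !mulrA.
Qed.

(* [J a i] and [H a i k] are the first and second derivatives of the
   transition map; names ending in [c] and [d] live in its source and target. *)
Variables (H : 'I_n -> 'I_n -> 'I_n -> F) (gd dud : 'I_n -> 'I_n -> F).
Variables (dgd : 'I_n -> 'I_n -> 'I_n -> F) (uc : 'I_n -> F) (duc : 'I_n -> 'I_n -> F).
Hypothesis Hsym : forall a i k, H a i k = H a k i.
Let ud a := \sum_i J a i * uc i.
Let gc i j := \sum_a \sum_b J a i * J b j * gd a b.
Let dgc m i j := \sum_a \sum_b
  (H a i m * J b j * gd a b + J a i * H b j m * gd a b +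
   J a i * J b j * (\sum_e J e m * dgd e a b)).
Hypothesis dudE : forall a k,
  \sum_e J e k * dud a e = \sum_i (H a i k * uc i + J a i * duc i k).

(** Differentiating the pulled-back metric creates second derivatives [H] of the transition map.
    They are exactly what the derivatives of [uc] lack, by [dudE], to become derivatives of [ud],
    provided the lower indices of [H] may be exchanged. *)
Lemma lie_pullback i j :
  \sum_m (uc m * dgc m i j + gc m j * duc m i + gc i m * duc m j) =
  \sum_a \sum_b J a i * J b j *
    (\sum_e (ud e * dgd e a b + gd e b * dud e a + gd a e * dud e b)).
Proof.
have T1 : \sum_m uc m * (\sum_a \sum_b J a i * J b j * (\sum_e J e m * dgd e a b)) =
    \sum_a \sum_b J a i * J b j * (\sum_e ud e * dgd e a b).
  under eq_bigr do rewrite mulr_sumr.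
  rewrite exchange_big/=; apply: eq_bigr => a _.
  under eq_bigr do rewrite mulr_sumr.
  rewrite exchange_big/=; apply: eq_bigr => b _.
  under eq_bigr do rewrite mulrCA.
  rewrite -mulr_sumr; congr (_ * _).
  under [LHS]eq_bigr do rewrite mulr_sumr.
  rewrite exchange_big/=; apply: eq_bigr => e _.
  by rewrite /ud mulr_suml; apply: eq_bigr => m _; ring.
(* The [H] term from the first Jacobian factor is grouped with [duc m i], so that [dudE] applies to
   their sum; [T3] does the same for the second factor. *)
have T2 : \sum_m (uc m * (\sum_a \sum_b H a i m * J b j * gd a b) + gc m j * duc m i) =
    \sum_a \sum_b J a i * J b j * (\sum_e gd e b * dud e a).
  transitivity (\sum_e \sum_b J b j * gd e b * (\sum_a J a i * dud e a)).
    transitivity (\sum_m \sum_e \sum_b J b j * gd e b * (H e m i * uc m + J e m * duc m i)).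
      apply: eq_bigr => m _; rewrite mulr_sumr mulr_suml -big_split/=.
      apply: eq_bigr => e _; rewrite mulr_sumr mulr_suml -big_split/=.
      by apply: eq_bigr => b _; rewrite (Hsym e i m); ring.
    rewrite exchange_big/=; apply: eq_bigr => e _.
    rewrite exchange_big/=; apply: eq_bigr => b _.
    by rewrite dudE mulr_sumr.
  under eq_bigr do under eq_bigr do rewrite mulr_sumr.
  under [RHS]eq_bigr do under eq_bigr do rewrite mulr_sumr.
  rewrite [RHS]exchange_big/= exchange_big/=; apply: eq_bigr => b _.
  rewrite exchange_big/=; apply: eq_bigr => a _; apply: eq_bigr => e _; ring.
have T3 : \sum_m (uc m * (\sum_a \sum_b J a i * H b j m * gd a b) + gc i m * duc m j) =
    \sum_a \sum_b J a i * J b j * (\sum_e gd a e * dud e b).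
  transitivity (\sum_e \sum_a J a i * gd a e * (\sum_b J b j * dud e b)).
    transitivity (\sum_m \sum_e \sum_a J a i * gd a e * (H e m j * uc m + J e m * duc m j)).
      apply: eq_bigr => m _; rewrite [in LHS]exchange_big/= mulr_sumr.
      rewrite /gc [X in _ + X * _]exchange_big/= mulr_suml -big_split/=.
      apply: eq_bigr => e _; rewrite mulr_sumr mulr_suml -big_split/=.
      by apply: eq_bigr => a _; rewrite (Hsym e j m); ring.
    rewrite exchange_big/=; apply: eq_bigr => e _.
    rewrite exchange_big/=; apply: eq_bigr => a _.
    by rewrite dudE mulr_sumr.
  under eq_bigr do under eq_bigr do rewrite mulr_sumr.
  under [RHS]eq_bigr do under eq_bigr do rewrite mulr_sumr.
  rewrite exchange_big/=; apply: eq_bigr => a _.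
  rewrite exchange_big/=; apply: eq_bigr => b _; apply: eq_bigr => e _; ring.
have -> : \sum_a \sum_b J a i * J b j *
      (\sum_e (ud e * dgd e a b + gd e b * dud e a + gd a e * dud e b)) =
    \sum_a \sum_b J a i * J b j * (\sum_e ud e * dgd e a b) +
    \sum_a \sum_b J a i * J b j * (\sum_e gd e b * dud e a) +
    \sum_a \sum_b J a i * J b j * (\sum_e gd a e * dud e b).
  rewrite -!big_split/=; apply: eq_bigr => a _; rewrite -!big_split/=.
  by apply: eq_bigr => b _; rewrite !big_split/=; ring.
rewrite -T1 -T2 -T3 -!big_split/=; apply: eq_bigr => m _.
have -> : dgc m i j = \sum_a \sum_b H a i m * J b j * gd a b +
    \sum_a \sum_b J a i * H b j m * gd a b +
    \sum_a \sum_b J a i * J b j * (\sum_e J e m * dgd e a b).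
  rewrite -!big_split/=; apply: eq_bigr => a _; rewrite -!big_split/=.
  by apply: eq_bigr.
by ring.
Qed.

End transition_algebra.

(** The equation makes [invmx gc *m J^T *m gd] a left inverse of [J]; for square matrices it is then
    also a right inverse. *)
Lemma inverse_metric_transform (F : fieldType) n (J gc gd : 'M[F]_n) :
  gc \in unitmx -> gd \in unitmx -> gc = J^T *m gd *m J ->
  J *m invmx gc *m J^T = invmx gd.
Proof.
move=> gcu gdu gcE.
have : invmx gc *m J^T *m gd *m J = 1%:M by rewrite -!mulmxA (mulmxA J^T) -gcE mulVmx.
move=> /mulmx1C; rewrite !mulmxA => E.
by rewrite -[LHS]mulmx1 -(mulmxV gdu) mulmxA E mul1mx.
Qed.

Lemma pd_eq_on (R : realType) n (U : set 'rV[R]_n) (f h : 'rV[R]_n -> R) x i :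
  open U -> U x -> (forall y, U y -> f y = h y) -> pd i f x = pd i h x.
Proof.
move=> oU Ux fh; apply: near_eq_pd; near=> y; apply: fh; near: y.
exact: open_nbhs_nbhs.
Unshelve. all: by end_near. Qed.

Section transition.
Variables (R : realType) (n : nat) (M : topologicalType) (A : smooth_atlas R n M).
Variable g : riemannian_metric A.
Variables c d : chart A.

Let ov : set 'rV[R]_n := coord c @` (cdom c `&` cdom d).
Let phi (x : 'rV[R]_n) : 'rV[R]_n := coord d (param c x).
Let J a i x := jac c d a i x.

Lemma overlap_cimg x : ov x -> cimg c x.
Proof. by move=> [m [cm _] <-]; exists m. Qed.

Lemma transition_cimg x : ov x -> cimg d (phi x).
Proof. by move=> [m [cm dm] <-]; rewrite /phi coordK//; exists m. Qed.

Lemma overlap_open : open ov.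
Proof.
have -> : ov = cimg c `&` param c @^-1` cdom d.
  apply/seteqP; split => [x [m [cm dm] <-]|x [cx dx]].
    by split; [exists m|rewrite /= coordK].
  exists (param c x); last exact: paramK.
  by split => //; exact: cdom_param.
apply: open_preimage_on; first exact: cimg_open.
  by move=> x cx; exact: continuous_param.
exact: open_cdom.
Qed.

Lemma transition_C2 k : C2on ov (fun x => phi x 0 k).
Proof. by apply: smooth_C2on; [exact: overlap_open|exact: smooth_transition]. Qed.

Lemma pd_transition (f : 'rV[R]_n -> R) x i : C1on (cimg d) f -> ov x ->
  differentiable (fun y => f (phi y)) x /\
  pd i (fun y => f (phi y)) x = \sum_k J k i x * pd k f (phi x).
Proof.
move=> fC ovx; have oo := overlap_open; have od : open (cimg d) by exact: cimg_open.
have [dif E] := pd_comp oo od (fun k => (transition_C2 k).1) transition_cimg fC ovx.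
by split; [exact: dif|exact: E].
Qed.

Lemma jac_C1 a i : C1on ov (J a i).
Proof. exact: (transition_C2 a).2. Qed.

Lemma pd_jac_sym a i k x : ov x -> pd k (J a i) x = pd i (J a k) x.
Proof. move=> ovx; exact: (pd_comm k i overlap_open (transition_C2 a) ovx). Qed.

Lemma metric_transition i j x : ov x ->
  g c x i j = \sum_a \sum_b J a i x * J b j x * g d (phi x) a b.
Proof. by move=> [m [cm dm] <-]; rewrite /phi coordK//; exact: metric_covariant. Qed.

Lemma field_transition (X : components A) : contravariant X ->
  forall x a, ov x -> X d (phi x) 0 a = \sum_i J a i x * X c x 0 i.
Proof. by move=> Xc x a [m [cm dm] <-]; rewrite /phi coordK//; exact: Xc. Qed.

(* (L_u g)_ij, which needs no connection: its transformation law uses only the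
   symmetry of the second derivatives of the transition map. *)
Definition lie_metric (u : components A) (e : chart A) (i j : 'I_n) (x : 'rV[R]_n) : R :=
  \sum_m (u e x 0 m * pd m (fun y => g e y i j) x + g e x m j * pd i (fun y => u e y 0 m) x
          + g e x i m * pd j (fun y => u e y 0 m) x).

Lemma lie_metric_transition (u : components A) x i j : contravariant u ->
  C1comp c u -> C1comp d u -> ov x ->
  lie_metric u c i j x = \sum_a \sum_b J a i x * J b j x * lie_metric u d a b (phi x).
Proof.
move=> uc ucC udC ovx; have oo := overlap_open.
pose H a i k := pd k (J a i) x.
have dJ a i' : differentiable (J a i') x := C1on_diff (jac_C1 a i') ovx.
have cx := overlap_cimg ovx.
have Hs a i' k : H a i' k = H a k i' by exact: pd_jac_sym.
pose dud a e := pd e (fun y => u d y 0 a) (phi x).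
pose duc a e := pd e (fun y => u c y 0 a) x.
have dudE a k : \sum_e J e k x * dud a e =
    \sum_i (H a i k * u c x 0 i + J a i x * duc i k).
  rewrite -(pd_transition k (udC a) ovx).2.
  rewrite (pd_eq_on k oo ovx (fun y oy => field_transition uc a oy)).
  have duC i' : differentiable (fun y => u c y 0 i') x := C1on_diff (ucC i') cx.
  rewrite pd_sum; first by apply: eq_bigr => i' _; rewrite (pdM k (dJ a i') (duC i')).
  by move=> i'; exact: differentiableM.
pose dgd e a b := pd e (fun y => g d y a b) (phi x).
have dgcE m i' j' : pd m (fun y => g c y i' j') x =
    \sum_a \sum_b (H a i' m * J b j' x * g d (phi x) a b + J a i' x * H b j' m * g d (phi x) a b
      + J a i' x * J b j' x * (\sum_e J e m x * dgd e a b)).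
  rewrite (pd_eq_on m oo ovx (fun y oy => metric_transition i' j' oy)).
  have dG a b := pd_transition m (@metric_C1 _ _ _ _ g d a b) ovx.
  have dJJ a b : differentiable (fun y => J a i' y * J b j' y) x by exact: differentiableM.
  have dJJG a b : differentiable (fun y => J a i' y * J b j' y * g d (phi y) a b) x.
    exact: (@differentiableM _ _ _ (fun y => g d (phi y) a b) x (dJJ a b) (dG a b).1).
  rewrite pd_sum; last by move=> a; apply: diff_sum.
  apply: eq_bigr => a _; rewrite pd_sum; last by move=> b; exact: dJJG.
  apply: eq_bigr => b _.
  rewrite (pdM m (dJJ a b) (dG a b).1) (pdM m (dJ a i') (dJ b j')) (dG a b).2.
  by rewrite mulrDl.
have := @lie_pullback R n (fun a i => J a i x) H (fun a b => g d (phi x) a b) dud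
  dgd (fun i => u c x 0 i) duc Hs dudE i j.
rewrite /lie_metric => E; under eq_bigr => m _.
  rewrite dgcE (metric_transition m j ovx) (metric_transition i m ovx).
  over.
rewrite [LHS]E; apply: eq_bigr => a _; apply: eq_bigr => b _; congr (_ * _); apply: eq_bigr => e _.
by rewrite (field_transition uc e ovx).
Qed.

Lemma dotc_transition (u v : components A) x : contravariant u -> contravariant v ->
  ov x -> dotc g u v c x = dotc g u v d (phi x).
Proof.
move=> uc vc ovx; rewrite /dotc /lower.
have E e y : \sum_k u e y 0 k * (\sum_l g e y k l * v e y 0 l) =
    \sum_k \sum_l u e y 0 k * v e y 0 l * g e y k l.
  by apply: eq_bigr => k _; rewrite mulr_sumr; apply: eq_bigr => l _; ring.
rewrite !E.
under eq_bigr do under eq_bigr do rewrite (metric_transition _ _ ovx).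
rewrite (@bilinear_pullback R n (fun a i => J a i x) (fun k => u c x 0 k)
  (fun k => v c x 0 k) (fun a b => g d (phi x) a b)).
by apply: eq_bigr => a _; apply: eq_bigr => b _; rewrite !field_transition.
Qed.

Lemma dfield_transition (v : components A) (f : 'rV[R]_n -> R) x : contravariant v ->
  C1on (cimg d) f -> ov x ->
  \sum_k v c x 0 k * pd k (fun y => f (phi y)) x = \sum_k v d (phi x) 0 k * pd k f (phi x).
Proof.
move=> vc fC ovx.
under eq_bigr do rewrite (pd_transition _ fC ovx).2 mulr_sumr.
rewrite exchange_big/=; apply: eq_bigr => a _.
rewrite (field_transition vc a ovx) mulr_suml; apply: eq_bigr => i _; ring.
Qed.

(** Differentials pull back by the transposed Jacobian, and the inverse metric pushes forward by the
    Jacobian on both sides; the gradient therefore transforms as a vector. *)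
Lemma gradient_transition (f : 'rV[R]_n -> R) x a : C1on (cimg d) f -> ov x ->
  \sum_k ginv g d (phi x) a k * pd k f (phi x) =
  \sum_i J a i x * (\sum_k ginv g c x i k * pd k (fun y => f (phi y)) x).
Proof.
move=> fC ovx.
pose Jm : 'M[R]_n := \matrix_(a, i) J a i x.
have gE : g c x = Jm^T *m g d (phi x) *m Jm.
  apply/matrixP => i j; rewrite (metric_transition i j ovx) !mxE.
  rewrite exchange_big/=; apply: eq_bigr => b _; rewrite !mxE mulr_suml.
  by apply: eq_bigr => e _; rewrite !mxE; ring.
have gcu := metric_unit g (overlap_cimg ovx).
have gdu := metric_unit g (transition_cimg ovx).
have giE := inverse_metric_transform gcu gdu gE.
pose dfd : 'cV[R]_n := \col_k pd k f (phi x).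
pose dfc : 'cV[R]_n := \col_k pd k (fun y => f (phi y)) x.
have dE : dfc = Jm^T *m dfd.
  apply/colP => i; rewrite !mxE (pd_transition i fC ovx).2.
  by apply: eq_bigr => k _; rewrite !mxE.
have : (invmx (g d (phi x)) *m dfd) a 0 = (Jm *m (invmx (g c x) *m dfc)) a 0.
  by rewrite dE !mulmxA giE.
move=> E; transitivity ((invmx (g d (phi x)) *m dfd) a 0).
  by rewrite mxE; apply: eq_bigr => k _; rewrite mxE.
rewrite E mxE; apply: eq_bigr => i _; rewrite !mxE; congr (_ * _).
by apply: eq_bigr => k _; rewrite mxE.
Qed.

(** F(chi) = g(u, v) u(chi) - mu (L_u g)(grad chi, v) + p v(chi): each ingredient has its own
    transformation law, and no Christoffel symbol remains. *)
Lemma flux_pair (mu : R) (u v : components A) (p chi : 'rV[R]_n -> R) (e : chart A) x :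
  cimg e x ->
  \sum_k flux g mu u v p e k x * pd k chi x =
  dotc g u v e x * (\sum_k u e x 0 k * pd k chi x)
  - mu * (\sum_a \sum_b (\sum_k ginv g e x a k * pd k chi x) * v e x 0 b * lie_metric u e a b x)
  + p x * (\sum_k v e x 0 k * pd k chi x).
Proof.
move=> ex.
rewrite -[X in _ - _ * X](@strn_pair R n (fun a b => g e x a b) (fun a b => ginv g e x a b)
  (fun i a b => pd i (fun y => g e y a b) x) (fun a b => metric_symE g a b ex)
  (fun a b => ginv_sym g a b ex) (fun i a b => pd_metric_sym g i a b ex)
  (fun a b => metric_ginv g ex a b) (fun k => u e x 0 k)
  (fun k i => pd i (fun y => u e y 0 k) x) (fun b => v e x 0 b) (fun k => pd k chi x)).
rewrite !mulr_sumr -sumrB -big_split/=; apply: eq_bigr => k _.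
rewrite /flux /lower /strain /covd /christoffel; ring.
Qed.

(* Only the functions W(chi), W being the flux, are compared between charts: the
   transformation law of W itself is never needed. *)
Lemma flux_pair_transition (mu : R) (u v : components A) (p chi : 'rV[R]_n -> R) x :
  contravariant u -> contravariant v -> C1comp c u -> C1comp d u ->
  C1on (cimg d) chi -> ov x ->
  \sum_k flux g mu u v (fun y => p (phi y)) c k x * pd k (fun y => chi (phi y)) x =
  \sum_k flux g mu u v p d k (phi x) * pd k chi (phi x).
Proof.
move=> uc vc ucC udC chiC ovx.
rewrite (flux_pair _ _ _ _ _ (overlap_cimg ovx)) (flux_pair _ _ _ _ _ (transition_cimg ovx)).
rewrite (dotc_transition uc vc ovx) (dfield_transition uc chiC ovx) (dfield_transition vc chiC ovx).
congr (_ - mu * _ + _).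
under eq_bigr do under eq_bigr do rewrite (lie_metric_transition _ _ uc ucC udC ovx).
rewrite (@bilinear_pullback R n (fun a i => J a i x)
  (fun a => \sum_k ginv g c x a k * pd k (fun y => chi (phi y)) x)
  (fun b => v c x 0 b) (fun a b => lie_metric u d a b (phi x))).
apply: eq_bigr => a _; apply: eq_bigr => b _.
by rewrite (field_transition vc b ovx) gradient_transition.
Qed.

End transition.

(** * Partitions of unity *)

Section square_of_positive_part.
Variable R : realType.

(* A C^1 cutoff suffices: only first derivatives of the partition of unity occur. *)
Definition sqpos (t : R) : R := Num.max 0 t ^+ 2.

(** A quadratic remainder treats the gluing point 0 of [sqpos] like any other, without one-sided
    limits. *)
Lemma is_derive_quadratic_bound (f : R -> R) (t d : R) :
  (forall h, `|f (t + h) - f t - d * h| <= h ^+ 2) -> is_derive t 1 f d.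
Proof.
move=> fb.
have cv : h^-1 *: ((f \o shift t) (h *: 1) - f t) @[h --> 0^'] --> d.
  apply/cvgrPdist_le => e e0; near=> h.
  have h0 : h != 0 by near: h; exact: nbhs_dnbhs_neq.
  have he : `|h| <= e by near: h; apply: dnbhs0_le.
  rewrite /= [h *: 1]mulr1 (addrC h t) -[h^-1 *: _]/(h^-1 * _).
  rewrite distrC (_ : _ - d = h^-1 * (f (t + h) - f t - d * h)); last by field.
  rewrite normrM normfV mulrC ler_pdivrMr ?normr_gt0// (le_trans (fb h))//.
  by rewrite -(real_normK (num_real h)) expr2 ler_wpM2r.
by split; [apply/cvg_ex; exists d|exact: cvg_lim cv].
Unshelve. all: by end_near. Qed.

Lemma is_derive_sqpos (t : R) : is_derive t 1 sqpos (2 * Num.max 0 t).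
Proof.
apply: is_derive_quadratic_bound => h; rewrite /sqpos ler_norml.
by case: (leP 0 t) => t0; case: (leP 0 (t + h)) => th; apply/andP; split; nra.
Qed.

Lemma continuous_maxr0 : continuous (fun t : R => Num.max 0 t).
Proof.
move=> t; apply: (@continuous_max R R (cst 0) id t); [exact: cst_continuous|exact: cvg_id].
Qed.

Lemma sqpos_gt0 t : (0 < sqpos t) = (0 < t).
Proof.
rewrite /sqpos; case: (leP t 0) => [t0|t0]; last by rewrite exprn_gt0.
by rewrite expr0n ltxx.
Qed.

Lemma sqpos_ge0 t : 0 <= sqpos t.
Proof. exact: sqr_ge0. Qed.

End square_of_positive_part.

Section bump.
Variables (R : realType) (n : nat).

Lemma C1on_coord (U : set 'rV[R]_n) i : open U -> C1on U (fun y => y 0 i).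
Proof.
move=> oU; apply: C1onI => // [x _|j]; first exact: differentiable_coord.
exists (fun=> (delta_mx 0 j : 'rV[R]_n) 0 i) => x _; split; last exact: cst_continuous.
rewrite /pd deriveE; last exact: differentiable_coord.
have lc : linear (fun N : 'rV[R]_n => N 0 i : R) by move=> a B D; rewrite !mxE.
pose L := GRing.isLinear.Build R 'rV[R]_n R *:%R (fun N : 'rV[R]_n => N 0 i : R) lc.
pose l : {linear 'rV[R]_n -> R} := HB.pack (fun N : 'rV[R]_n => N 0 i : R) L.
rewrite (@diff_lin _ _ _ l)//.
by move=> y; apply: (@coord_continuous R 1 n 0 i y).
Qed.

Lemma bump_rV (x0 : 'rV[R]_n) (r : R) : 0 < r -> exists psi : 'rV[R]_n -> R,
  [/\ C1on setT psi, (forall y, 0 <= psi y), (forall y, `|y - x0| < r -> 0 < psi y) &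
      forall y, psi y != 0 -> `|y - x0| <= r].
Proof.
(* Balls of the maximum norm are cubes: [q i] is positive exactly while coordinate [i] is within [r]
   of that of [x0], and a single nonpositive [q i] kills the product. *)
move=> r0; pose q (i : 'I_n) (y : 'rV[R]_n) := 1 - ((y 0 i - x0 0 i) / r) ^+ 2.
exists (fun y => \prod_i sqpos (q i y)); split.
- apply: C1on_prod; first exact: openT.
  move=> i; apply: (@C1on_comp1 _ _ setT (q i) (@sqpos R)
    (fun t => 2 * Num.max 0 t) openT _ _).1.
    apply: (C1onB openT (@C1on_cst _ _ _ 1)).
    have lC : C1on setT (fun y : 'rV[R]_n => (y 0 i - x0 0 i) / r).
      apply: (C1onM openT _ (@C1on_cst _ _ _ r^-1)).
      exact: (C1onB openT (C1on_coord i openT) (@C1on_cst _ _ _ (x0 0 i))).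
    exact: (C1onM openT lC lC).
  move=> y _; split; first exact: is_derive_sqpos.
  by apply: continuousM; [exact: cst_continuous|exact: continuous_maxr0].
- by move=> y; apply: prodr_ge0 => i _; exact: sqpos_ge0.
- move=> y yr; apply: prodr_gt0 => i _; rewrite sqpos_gt0 subr_gt0.
  have := le_lt_trans (rV_norm_le (y - x0) i) yr; rewrite !mxE => yi.
  by rewrite -(real_normK (num_real _)) normrM normfV (gtr0_norm r0) expr_lt1//
    ?ltr_pdivrMr ?mul1r// divr_ge0// ltW.
- move=> y; apply: contraNle => ry.
  have [i yi] : exists i, r < `|y 0 i - x0 0 i|.
    apply: contrapT => /forallNP H; move: ry; rewrite ltNge => /negP; apply.
    apply: rV_norm_leP; first exact: ltW.
    by move=> i; have := H i => /negP; rewrite -leNgt !mxE.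
  rewrite (bigD1 i)//= mulf_eq0; apply/orP; left.
  apply: contraTT (sqpos_ge0 (q i y)) => sn0.
  have : 0 < sqpos (q i y) by rewrite lt_neqAle eq_sym sn0 sqpos_ge0.
  rewrite sqpos_gt0 subr_gt0 -(real_normK (num_real _)) normrM normfV (gtr0_norm r0).
  rewrite expr_lt1//; last by apply: divr_ge0 => //; exact: ltW.
  by rewrite ltr_pdivrMr// mul1r => /(lt_trans yi); rewrite ltxx.
Qed.

End bump.

Section partition_of_unity.
Variables (R : realType) (n : nat) (M : ptopologicalType).
Hypotheses (M_hausdorff : hausdorff_space M) (M_compact : compact [set: M]).
Variable A : smooth_atlas R n M.

Definition C1M (f : M -> R) := forall c : chart A, C1on (cimg c) (fun x => f (param c x)).

Lemma chart_continuous (f : M -> R) (fc : chart A -> 'rV[R]_n -> R) :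
  (forall c x, cimg c x -> f (param c x) = fc c x /\ {for x, continuous (fc c)}) ->
  continuous f.
Proof.
move=> fP m; pose c := chart_at A m; have cm : cdom c m by exact: cdom_chart_at.
apply: (@near_eq_continuous M R (fun m' => fc c (coord c m')) f m).
  near=> m'; have cm' : cdom c m' by near: m'; apply: open_nbhs_nbhs; split => //; exact: open_cdom.
  by rewrite -(fP c _ (cimg_coord cm')).1 coordK.
apply: continuous_comp; first exact: continuous_coord.
exact: (fP c _ (cimg_coord cm)).2.
Unshelve. all: by end_near. Qed.

Lemma C1M_continuous f : C1M f -> continuous f.
Proof.
move=> fC; apply: (chart_continuous (fc := fun c x => f (param c x))) => c x cx.
by split => //; exact: C1on_cont (fC c) cx.
Qed.

Lemma param_image_closed (c : chart A) (K : set 'rV[R]_n) : compact K -> K `<=` cimg c ->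
  closed (param c @` K).
Proof.
move=> cK Kc; apply: compact_closed => //; apply: continuous_compact => //.
apply: continuous_in_subspaceT => x; rewrite inE => Kx.
exact: continuous_param (Kc _ Kx).
Qed.

(** A bump in the preferred chart at [m], extended by zero. Compactness of [K] and the Hausdorff
    property make its image in M closed, which lets the extension be C^1. The function and its
    supporting compact set form a pair so that one choice selects both. *)
Lemma bump_M (m : M) : exists bK : (M -> R) * set 'rV[R]_n,
  let b := bK.1 in let K := bK.2 in let c := chart_at A m in
  [/\ C1M b, (forall m', 0 <= b m'), 0 < b m, compact K /\ K `<=` cimg c &
      forall m', b m' != 0 -> cdom c m' /\ K (coord c m')].
Proof.
pose c := chart_at A m; have cm : cdom c m by exact: cdom_chart_at.
pose x0 := coord c m.
have /nbhs_ballP[e /= e0 He] : nbhs x0 (cimg c).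
  by apply: open_nbhs_nbhs; split; [exact: cimg_open|exact: cimg_coord].
pose r := e / 2; have r0 : 0 < r by exact: divr_gt0.
pose K := [set x : 'rV[R]_n | `|x - x0| <= r].
have Kc : K `<=` cimg c.
  move=> x /= xr; apply: He; rewrite -ball_normE/= distrC (le_lt_trans xr)//.
  by rewrite /r ltr_pdivrMr// ltr_pMr// ltr1n.
have cK : compact K.
  have -> : K = (fun x => x + x0) @` [set x : 'rV[R]_n | `|x| <= r].
    apply/seteqP; split => [x xr|x [y yr <-]]; last by rewrite /K/= addrK.
    by exists (x - x0) => //; rewrite subrK.
  apply: continuous_compact; last exact: compact_cball_rV.
  by apply: continuous_subspaceT; exact: continuous_translation.
have [psi [psiC psi0 psi_gt0 psiK]] := bump_rV x0 r0.
pose b m' := if `[< cdom c m' >] then psi (coord c m') else 0.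
have bE m' : cdom c m' -> b m' = psi (coord c m') by rewrite /b; case: asboolP.
have bN m' : ~ (param c @` K) m' -> b m' = 0.
  rewrite /b; case: asboolP => // cm' Km'.
  have [//|/psiK Kx] := eqVneq (psi (coord c m')) 0.
  by case: Km'; exists (coord c m') => //; exact: coordK.
exists (b, K); split => //=.
- move=> d x dx.
  (* Off the image of [K] the bump is zero on an open set; on it, the point lies in the overlap of
     both charts and the bump is [psi] composed with the transition map. *)
  have [Km|Km] := pselect ((param c @` K) (param d x)); last first.
    pose U2 := cimg d `&` param d @^-1` (~` (param c @` K)).
    have oU2 : open U2.
      apply: open_preimage_on; first exact: cimg_open.
        by move=> y dy; exact: continuous_param.
      by apply: closed_openC; exact: param_image_closed.
    apply: (@eq_C1on _ _ U2 (fun=> 0)) => //; last exact: C1on_cst.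
    by move=> y [dy yK]; rewrite bN.
  pose U1 := coord d @` (cdom d `&` cdom c).
  have oU1 : open U1 by exact: overlap_open.
  have bC : C1on U1 (fun y => psi (coord c (param d y))).
    apply: (@C1on_comp _ _ _ U1 setT (fun y => coord c (param d y)) psi) => //.
    + exact: openT.
    + by move=> k; exact: (transition_C2 d c k).1.
  apply: (eq_C1on oU1 _ bC).
    by move=> y [m' [dm' cm'] <-]; rewrite coordK// bE.
  case: Km => y Ky yE; exists (param d x); last exact: paramK.
  by split; [exact: cdom_param|rewrite -yE; apply: cdom_param; exact: Kc].
- by move=> m'; rewrite /b; case: asboolP.
- by rewrite bE// psi_gt0// subrr normr0.
- move=> m' bm'; have [cm'|ncm'] := pselect (cdom c m').
    by split => //; apply: psiK; rewrite -bE.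
  by move: bm'; rewrite /b asboolF// eqxx.
Qed.

(** The indices are points of M, an index [i] standing for its preferred chart; finiteness lies in
    the list [s]. Finitely many bumps are positive somewhere at each point, and each bump is divided
    by their sum. *)
Lemma partition_of_unity : exists (s : seq M) (chi : M -> M -> R) (K : M -> set 'rV[R]_n),
  [/\ (forall i, C1M (chi i)), (forall m, \sum_(i <- s) chi i m = 1),
      (forall i, compact (K i) /\ K i `<=` cimg (chart_at A i)) &
      forall i m, chi i m != 0 -> cdom (chart_at A i) m /\ K i (coord (chart_at A i) m)].
Proof.
have /choice[bK bP] := bump_M.
pose b i := (bK i).1; pose K i := (bK i).2.
have bC i : continuous (b i) by apply: C1M_continuous; have [] := bP i.
have := M_compact; rewrite compact_cover => /(_ M setT (fun i => [set m | 0 < b i m])).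
move=> [||D _ Dcov].
- move=> i _; rewrite (_ : mkset _ = b i @^-1` [set y | 0 < y])//.
  by apply: open_comp => [m _|]; [exact: bC|exact: open_gt].
- by move=> m _; exists m => //; have [] := bP m.
pose s : seq M := finmap.enum_fset D.
pose B m := \sum_(i <- s) b i m.
have b0 i m : 0 <= b i m by have [_ bi0 _ _ _] := bP i; exact: bi0.
have B0 m : 0 < B m.
  have [i iD bi] := Dcov m I.
  rewrite /B (big_rem i (iD : i \in s))/=.
  by apply: ltr_pwDl => //; apply: sumr_ge0.
have BC (c : chart A) : C1on (cimg c) (fun x => B (param c x)).
  apply: C1on_sum; first exact: cimg_open.
  by move=> i; have [bCi _ _ _ _] := bP i; exact: bCi.
exists s, (fun i m => b i m / B m), K; split.
- move=> i c; apply: C1onM; first exact: cimg_open.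
    by have [bCi _ _ _ _] := bP i; exact: bCi.
  apply: C1onV; first exact: cimg_open; last exact: BC.
  by move=> x _; rewrite gt_eqF.
- by move=> m; rewrite -mulr_suml -/(B m) divff// (gt_eqF (B0 m)).
- by move=> i; have [_ _ _ Ki _] := bP i; exact: Ki.
- move=> i m bm; have [_ _ _ _] := bP i; apply.
  by apply: contraNneq bm => bi0; rewrite /b bi0 mul0r.
Qed.

End partition_of_unity.

(** * Integration over the manifold *)

Section extension_by_zero.
Variables (R : realType) (n : nat) (U K : set 'rV[R]_n) (f : 'rV[R]_n -> R).
Hypotheses (oU : open U) (cK : compact K) (KU : K `<=` U) (fC : C1on U f).
Hypothesis fK : forall x, U x -> f x != 0 -> K x.

Definition ext0 (x : 'rV[R]_n) : R := if `[< U x >] then f x else 0.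

Lemma ext0E x : U x -> ext0 x = f x.
Proof. by rewrite /ext0; case: asboolP. Qed.

Lemma ext0_eq0 x : ~ K x -> ext0 x = 0.
Proof.
rewrite /ext0; case: asboolP => // Ux nKx; have [//|/(fK Ux)//] := eqVneq (f x) 0.
Qed.

Lemma open_compactC : open (~` K).
Proof. by apply: closed_openC; apply: compact_closed => //; exact: norm_hausdorff. Qed.

(** [U] and the complement of [K] are open and cover the space; the extension is [f] on one and zero
    on the other. *)
Lemma C1on_ext0 : C1on setT ext0.
Proof.
move=> x _; have [Ux|nUx] := pselect (U x).
  by apply: (@eq_C1on _ _ U f) => // y Uy; rewrite ext0E.
apply: (@eq_C1on _ _ (~` K) (fun=> 0)); last by move=> Kx; apply: nUx; exact: KU.
- exact: open_compactC.
- by move=> y Ky; rewrite ext0_eq0.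
- exact: C1on_cst.
Qed.

Lemma pd_ext0 x k : U x -> pd k ext0 x = pd k f x.
Proof. by move=> Ux; apply: (pd_eq_on k oU Ux) => y; exact: ext0E. Qed.

Lemma pd_ext0_eq0 x k : ~ K x -> pd k ext0 x = 0.
Proof.
move=> nKx; apply: (C1on_pd_eq0 _ open_compactC nKx) => y nKy.
exact: ext0_eq0.
Qed.

End extension_by_zero.

Lemma compact_bounded_fun (R : realType) (T : topologicalType) (K : set T) (f : T -> R) :
  compact K -> (forall x, K x -> {for x, continuous f}) ->
  exists2 C : R, 0 <= C & forall x, K x -> `|f x| <= C.
Proof.
move=> cK fc; have [[x0 Kx0]|K0] := pselect (K !=set0); last first.
  by exists 0 => // x Kx; exfalso; apply: K0; exists x.
have [|||x Kx Hx] := @compact_EVT_max T R (fun x => `|f x|) K.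
- by exists x0.
- by [].
- apply: continuous_in_subspaceT => x; rewrite inE => Kx.
  by apply: continuous_comp; [exact: fc|exact: norm_continuous].
exists `|f x|; first exact: normr_ge0.
by move=> y Ky; apply: Hx; rewrite inE.
Qed.

Lemma compact_norm_le (R : realType) n (K : set 'rV[R]_n) : compact K ->
  exists2 r : R, 0 <= r & forall x, K x -> `|x| <= r.
Proof.
move=> cK; have [|r r0 Hr] := compact_bounded_fun (f := fun x : 'rV[R]_n => `|x|) cK.
  by move=> x _; exact: norm_continuous.
by exists r => // x Kx; have := Hr x Kx; rewrite normr_id.
Qed.

(** A nonnegative density passes through positive parts, which carries [integral_chart] over to
    functions of either sign. *)
Lemma maxe_EFin_mul (R : realType) (a v : R) : 0 <= v ->
  (maxe a%:E 0 * v%:E = maxe (v * a)%:E 0)%E.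
Proof.
move=> v0; rewrite -!EFin_max -EFinM; congr EFin.
by case: (leP a 0) => a0; case: (leP (v * a) 0) => va; nra.
Qed.

Section riemannian_integral.
Variables (R : realType) (n : nat) (M : ptopologicalType).
Hypotheses (M_hausdorff : hausdorff_space M) (M_compact : compact [set: M]).
Variables (A : smooth_atlas R n M) (g : riemannian_metric A).
Variable omega : {measure set (borel M) -> \bar R}.
Hypothesis omega_vol : is_riemannian_volume g omega.
Variable lam : {measure set (borel 'rV[R]_n) -> \bar R}.
Hypothesis lamE : forall f : borel 'rV[R]_n -> \bar R, measurable_fun setT f ->
  (forall x, 0 <= f x)%E -> (\int[lam]_x f x)%E = lebesgue_int f.

Lemma measurable_cdom (c : chart A) : measurable (cdom c : set (borel M)).
Proof. by apply: borel_open; exact: open_cdom. Qed.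

Lemma measurable_cimg (c : chart A) : measurable (cimg c : set (borel 'rV[R]_n)).
Proof. by apply: borel_open; exact: cimg_open. Qed.

Lemma measurable_param (c : chart A) :
  measurable_fun (cimg c : set (borel 'rV[R]_n)) (param c : _ -> borel M).
Proof.
apply: borel_measurable_fun; first exact: cimg_open.
by move=> x cx; exact: continuous_param.
Qed.

Lemma measurable_indic_param (c : chart A) (B : set (borel M)) : measurable B ->
  measurable_fun (cimg c : set (borel 'rV[R]_n)) (fun x => \1_B (param c x) : R).
Proof.
move=> mB; apply: (@measurable_comp _ _ _ (borel 'rV[R]_n) (borel M) _ setT) => //.
exact: measurable_param.
Qed.

Lemma measurable_vol (c : chart A) :
  measurable_fun (cimg c : set (borel 'rV[R]_n)) (vol g c).
Proof.
apply: borel_measurable_funR; first exact: cimg_open.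
by move=> x cx; exact: C1on_cont (@vol_C1 _ _ _ _ g c) cx.
Qed.

Lemma integral_chart (c : chart A) (e : borel M -> \bar R) :
  measurable_fun (cdom c : set (borel M)) e -> (forall m, cdom c m -> 0 <= e m)%E ->
  (\int[omega]_(m in cdom c) e m =
   \int[lam]_(x in cimg c) (e (param c x) * (vol g c x)%:E))%E.
Proof.
move=> me e0; apply: (@integral_density _ _ (borel M) (borel 'rV[R]_n) R omega lam) => //.
- exact: measurable_cdom.
- exact: measurable_cimg.
- exact: measurable_param.
- by move=> x cx; exact: cdom_param.
- exact: measurable_vol.
- by move=> x _; exact: sqrtr_ge0.
move=> B mB Bc; rewrite (omega_vol mB Bc) integral_mkcond.
(* [lebesgue_int] ranges over all of R^n, so the integrand is extended by zero off the chart image,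
   where the indicator of [coord c] of [B] vanishes. *)
pose h : borel 'rV[R]_n -> \bar R :=
  (fun x : borel 'rV[R]_n => (\1_B (param c x) * vol g c x)%:E) \_ (cimg c).
have mh : measurable_fun setT h.
  apply/(measurable_restrictT _ _).1; first exact: measurable_cimg.
  apply/measurable_EFinP; apply: measurable_funM; last exact: measurable_vol.
  exact: measurable_indic_param.
have h0 x : (0 <= h x)%E.
  by rewrite /h patchE; case: ifP => // _; rewrite lee_fin mulr_ge0// sqrtr_ge0.
rewrite -[RHS]/(\int[lam]_x h x)%E lamE//; congr lebesgue_int.
apply/funext => x; rewrite /h patchE; case: ifPn => [|cx].
  rewrite inE => cx; congr ((_ * _)%:E); rewrite !indicE; congr (_%:R).
  have [Bx|nBx] := pselect (B (param c x)).
    by rewrite !mem_set//; exists (param c x) => //; exact: paramK.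
  rewrite !memNset// => -[m Bm mx]; apply: nBx; rewrite -mx coordK//; exact: Bc.
rewrite indicE memNset ?mul0r// => -[m Bm mx]; move/negP: cx; apply.
by rewrite inE; exists m => //; exact: Bc.
Qed.

Lemma integrable_continuous (f : M -> R) : (omega setT < +oo)%E -> continuous f ->
  omega.-integrable setT (fun m : borel M => (f m)%:E).
Proof.
move=> ofin fc; have [C C0 fC] := compact_bounded_fun M_compact (fun m _ => fc m).
have iC := @integrableZl _ (borel M) R omega setT measurableT C _
  (integrable_indic_lty measurableT ofin).
apply: (le_integrable measurableT _ _ iC).
  apply/measurable_EFinP; apply: borel_measurable_funR; first exact: openT.
  by move=> m _; exact: fc.
move=> m _; rewrite -EFinM /= lee_fin indicT mulr1 (ger0_norm C0).
exact: fC.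
Qed.

Lemma integrable_continuous_rV (f : 'rV[R]_n -> R) (r : R) : continuous f ->
  (forall x, r < `|x| -> f x = 0) ->
  lam.-integrable setT (fun x : borel 'rV[R]_n => (f x)%:E).
Proof.
move=> fc f0; have [C C0 fC] := continuous_bounded_cball r fc.
have iB := integrable_indic_lty (borel_closed (@closed_cball_rV R n r))
  (measure_cball_rV lamE r).
have iC := @integrableZl _ (borel 'rV[R]_n) R lam setT measurableT C _ iB.
apply: (le_integrable measurableT _ _ iC).
  apply/measurable_EFinP; apply: borel_measurable_funR; first exact: openT.
  by move=> x _; exact: fc.
move=> x _; rewrite -EFinM /= lee_fin [leRHS]ger0_norm ?mulr_ge0//.
have [xr|xr] := leP `|x| r; last by rewrite f0// normr0 mulr_ge0.
by rewrite indicE mem_set// mulr1 fC.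
Qed.

(** [F] already contains the density. Since [E] vanishes off one chart domain, its integral is a
    Lebesgue integral in that chart, and the compact support lets each [F k] be extended by zero to
    R^n. *)
Lemma chart_divergence (c : chart A) (K : set 'rV[R]_n) (F : 'I_n -> 'rV[R]_n -> R)
    (E : M -> R) : compact K -> K `<=` cimg c -> (forall k, C1on (cimg c) (F k)) ->
  (forall k x, cimg c x -> F k x != 0 -> K x) -> continuous E ->
  (forall m, E m != 0 -> cdom c m) ->
  (forall x, cimg c x -> vol g c x * E (param c x) = \sum_k pd k (F k) x) ->
  (\int[omega]_(m in [set: borel M]) (E m)%:E = 0)%E.
Proof.
move=> cK Kc FC FK cE Ec EF.
have [r r0 Kr] := compact_norm_le cK.
pose F0 k := ext0 (cimg c) (F k).
have oc : open (cimg c) by exact: cimg_open.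
have F0C k : C1on setT (F0 k) by exact: C1on_ext0 oc cK Kc (FC k) (FK k).
have nK x : r < `|x| -> ~ K x by move=> rx /Kr; rewrite leNgt rx.
have mE : measurable_fun (cdom c : set (borel M)) (fun m => (E m)%:E).
  apply/measurable_EFinP; apply: borel_measurable_funR; first exact: open_cdom.
  by move=> m _; exact: cE.
transitivity (\int[omega]_(m in (cdom c : set (borel M))) (E m)%:E)%E.
  rewrite [RHS]integral_mkcond; apply: eq_integral => m _; rewrite patchE.
  case: ifPn => // /negP cm; have [->//|/Ec cm'] := eqVneq (E m) 0.
  by exfalso; apply: cm; rewrite inE.
transitivity (\int[lam]_(x in (cimg c : set (borel 'rV[R]_n)))
    (\sum_k pd k (F0 k) x)%:E)%E.
  have v0 x : 0 <= vol g c x by exact: sqrtr_ge0.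
  have EF0 x : cimg c x -> \sum_k pd k (F0 k) x = vol g c x * E (param c x).
    by move=> cx; rewrite EF//; apply: eq_bigr => k _; exact: pd_ext0.
  rewrite integralE [RHS]integralE; congr (_ - _)%E.
    rewrite integral_chart//; last exact: measurable_funepos.
    apply: eq_integral => x; rewrite inE => cx; rewrite !funeposE.
    by rewrite EF0// maxe_EFin_mul.
  rewrite integral_chart//; last exact: measurable_funeneg.
  apply: eq_integral => x; rewrite inE => cx; rewrite !funenegE.
  by rewrite EF0// -!EFinN maxe_EFin_mul// mulrN.
transitivity (\int[lam]_x (\sum_k (pd k (F0 k) x)%:E))%E.
  rewrite [LHS]integral_mkcond; apply: eq_integral => x _; rewrite patchE.
  rewrite sumEFin; case: ifPn => // /negP cx; rewrite big1// => k _.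
  apply: (pd_ext0_eq0 cK (FK k)) => /Kc cx'; apply: cx; rewrite inE//.
have pc k : continuous (pd k (F0 k)) by move=> x; exact: C1on_pd (F0C k) I.
rewrite integral_sum//; last first.
  move=> k; apply: (integrable_continuous_rV (r := r)) => //.
  by move=> x rx; apply: (pd_ext0_eq0 cK (FK k)); exact: nK.
apply: big1 => k _; apply: (integral_pd_eq0 lamE (r := r)) => //.
- by move=> x; exact: C1on_cont (F0C k) I.
- by move=> x; apply: diff_derivable; exact: C1on_diff (F0C k) I.
- by move=> x rx; apply: (ext0_eq0 (FK k)); exact: nK.
Qed.

(** [is_riemannian_volume] prescribes the measure only inside chart domains. Finitely many compact
    sets lying in charts cover M, and each has finite volume because the density is bounded on
    it. *)
Lemma riemannian_volume_finite : (omega setT < +oo)%E.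
Proof.
have [s [chi [K [_ chi1 cK chiK]]]] := partition_of_unity M_hausdorff M_compact A.
pose B i : set (borel M) := param (chart_at A i) @` K i.
have mB i : measurable (B i).
  apply: borel_closed; apply: (param_image_closed M_hausdorff); [exact: (cK i).1|exact: (cK i).2].
have Bfin i : (omega (B i) < +oo)%E.
  pose c := chart_at A i; have [cKi Kc] := cK i.
  have Bc : B i `<=` cdom c by move=> _ [x Kx <-]; apply: cdom_param; exact: Kc.
  have [C C0 vC] := compact_bounded_fun cKi
    (fun x Kx => C1on_cont (@vol_C1 _ _ _ _ g c) (Kc x Kx)).
  have [r r0 Kr] := compact_norm_le cKi.
  have mb := borel_closed (@closed_cball_rV R n r).
  have -> : omega (B i) = (\int[omega]_(m in (cdom c : set (borel M))) (\1_(B i) m)%:E)%E.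
    rewrite integral_indic//; last exact: measurable_cdom.
    by congr (omega _); apply/esym/setIidPl.
  rewrite integral_chart//; last first.
    by apply/measurable_EFinP; apply: measurable_funTS; exact: measurable_indic.
  have iC := @integrableZl _ (borel 'rV[R]_n) R lam setT measurableT C _
    (integrable_indic_lty mb (measure_cball_rV lamE r)).
  have /integrableP[_] := iC; apply: le_lt_trans.
  rewrite [leLHS]integral_mkcond; apply: ge0_le_integral => //.
  - move=> x _; rewrite patchE; case: ifP => // _.
    by rewrite -EFinM lee_fin mulr_ge0// sqrtr_ge0.
  - apply/(measurable_restrictT _ _).1; first exact: measurable_cimg.
    under eq_fun do rewrite -EFinM.
    apply/measurable_EFinP; apply: measurable_funM; last exact: measurable_vol.
    exact: measurable_indic_param.
  - apply: measurableT_comp => //; by have /integrableP[] := iC.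
  move=> x _; rewrite patchE -EFinM; case: ifPn => [|_]; last exact: abse_ge0.
  rewrite inE => cx; rewrite /= lee_fin [leRHS]ger0_norm ?mulr_ge0// mulrC.
  have [Bx|nBx] := pselect (B i (param c x)); last first.
    by rewrite indicE memNset// mulr0 mulr_ge0.
  have Kx : K i x.
    case: Bx => y Ky /(congr1 (coord c)); rewrite !paramK//; last exact: Kc.
    by move=> <-.
  rewrite !indicE !mem_set//; last exact: Kr.
  by rewrite !mulr1 (le_trans (ler_norm _))// vC.
(* The functions sum to 1, so at every point one of them is nonzero and places the point in its
   compact set. *)
have sub : [set: borel M] `<=` \big[setU/set0]_(i <- s) B i.
  move=> m _; have : \sum_(i <- s) chi i m != 0 by rewrite chi1 oner_neq0.
  apply: contra_neqP => nB; rewrite big_seq big1// => i si.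
  have [//|/chiK[cm Km]] := eqVneq (chi i m) 0; exfalso; apply: nB.
  rewrite (big_rem i si)/=; left; exists (coord (chart_at A i) m) => //.
  exact: coordK.
have mU (r : seq M) : measurable (\big[setU/set0]_(i <- r) B i).
  by apply: bigsetU_measurable.
apply: (@le_lt_trans _ _ (omega (\big[setU/set0]_(i <- s) B i))).
  by apply: le_measure; rewrite ?inE//; exact: mU.
elim: s {chi1 sub} => [|i s IH]; first by rewrite big_nil measure0.
rewrite big_cons; apply: (le_lt_trans (measureU2 _ (mB i) (mU s))).
by apply: lte_add_pinfty; [exact: Bfin|exact: IH].
Qed.

End riemannian_integral.

(** * The divergence theorem for the force *)

Section conservation.
Variables (R : realType) (n : nat) (M : ptopologicalType).
Hypotheses (M_hausdorff : hausdorff_space M) (M_compact : compact [set: M]).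
Variables (A : smooth_atlas R n M) (g : riemannian_metric A).

Lemma gdotE (X Y : components A) m :
  gdot g X Y m = dotc g X Y (chart_at A m) (coord (chart_at A m) m).
Proof.
rewrite /gdot /dotc /lower mxE.
under eq_bigr do rewrite !mxE mulr_suml.
rewrite exchange_big/=; apply: eq_bigr => k _; rewrite mulr_sumr.
by apply: eq_bigr => l _; rewrite mulrA.
Qed.

Lemma gdot_chart (X Y : components A) (c : chart A) m : contravariant X ->
  contravariant Y -> cdom c m -> gdot g X Y m = dotc g X Y c (coord c m).
Proof.
move=> Xc Yc cm; have am := cdom_chart_at A m; rewrite gdotE.
rewrite (@dotc_transition _ _ _ _ g _ c X Y)//; last by exists m.
by rewrite coordK.
Qed.

Variable omega : {measure set (borel M) -> \bar R}.
Hypothesis omega_vol : is_riemannian_volume g omega.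

Section divergence_form.
Variables (W U V : components A) (P : M -> R) (mu : R).
Hypotheses (Wcv : contravariant W) (Ucv : contravariant U) (Vcv : contravariant V).
Hypothesis (Wcont : forall c k x, cimg c x -> {for x, continuous (fun y => W c y 0 k)}).
Hypotheses (UC : forall c, C2comp c U) (VC : forall c, C1comp c V).
Hypothesis PC : forall c : chart A, C1on (cimg c) (fun x => P (param c x)).
Hypothesis V_killing : killing g V.
Hypothesis balance : forall c x, cimg c x ->
  (forall k, W c x 0 k + advection g U c k x - mu * diffusion g U c k x + grad g P c k x = 0)
  /\ div g U c x = 0.

Let fluxP c k x := flux g mu U V (fun y => P (param c y)) c k x.

(** [W] stands for u_t at one fixed instant: the vanishing of the integral of g(u_t, v) involves no
    further information on the time dependence. *)
Lemma flux_div_force c x : cimg c x ->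
  \sum_k (pd k (fluxP c k) x + (\sum_i christoffel g c i i k x) * fluxP c k x) =
  - dotc g W V c x.
Proof.
move=> cx; have [bal div0] := balance cx.
rewrite /fluxP (@flux_div _ _ _ _ g mu U V (fun y => P (param c y)) c x)//; last first.
  exact: V_killing.
rewrite /dotc -sumrN; apply: eq_bigr => j _; rewrite -[RHS]mulNr; congr (_ * _).
apply/eqP; rewrite -addr_eq0 addrC -{2}(bal j); apply/eqP.
by rewrite /grad; ring.
Qed.

Lemma dotcWV_cont c x : cimg c x -> {for x, continuous (dotc g W V c)}.
Proof.
move=> cx; apply: continuous_sum_fun => k; apply: continuousM; first exact: Wcont.
have lC : C1on (cimg c) (lower g V c k)
    by move=> y cy; apply: (lower_C1 g k (@VC c) cy).
exact: C1on_cont lC cx.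
Qed.

(* With h = g(W, V) and F the flux, each [E i] = - chi_i h + F(chi_i) is chart
   independent and vol * E_i = sum_k d_k (vol chi_i F^k) in every chart. Its
   integral therefore vanishes, and the [E i] sum up to - h as sum_i chi_i = 1. *)
Lemma force_integral_eq0 : (\int[omega]_(m in [set: borel M]) (gdot g W V m)%:E = 0)%E.
Proof.
have [lam lamE] := lebesgue_int_measure R n.
have [s [chi [K [chiC chi1 cK chiK]]]] := partition_of_unity M_hausdorff M_compact A.
pose Wc i c x := \sum_k fluxP c k x * pd k (fun y => chi i (param c y)) x.
pose E i m := - (chi i m * gdot g W V m) + Wc i (chart_at A m) (coord (chart_at A m) m).
have EE i c x : cimg c x -> E i (param c x) =
    - (chi i (param c x) * dotc g W V c x) + Wc i c x.
  move=> cx; have cm := cdom_param cx; rewrite /E (gdot_chart Wcv Vcv cm) paramK//.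
  congr (_ + _); set m := param c x; set d := chart_at A m.
  have dm : cdom d m by exact: cdom_chart_at.
  have ov : (coord c @` (cdom c `&` cdom d)) x by exists m => //; exact: paramK.
  have oo := @overlap_open _ _ _ _ c d.
  have pm y : (coord c @` (cdom c `&` cdom d)) y -> param d (coord d (param c y)) = param c y.
    by move=> [m' [cm' dm'] <-]; rewrite coordK// coordK.
  have := @flux_pair_transition _ _ _ _ g c d mu U V (fun y => P (param d y))
    (fun y => chi i (param d y)) x Ucv Vcv (C2comp_C1 (@UC c)) (C2comp_C1 (@UC d)) (@chiC i d) ov.
  rewrite /Wc -/m => <-; apply: eq_bigr => k _; congr (_ * _).
    by rewrite /fluxP /flux pm.
  by apply: (pd_eq_on k oo ov) => y oy; rewrite pm.
have fC c k : C1on (cimg c) (fluxP c k) by exact: flux_C1.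
have Econt i : continuous (E i).
  apply: (chart_continuous (fc := fun c x => - (chi i (param c x) * dotc g W V c x) + Wc i c x)).
  move=> c x cx; split; first exact: EE.
  apply: continuousD; last first.
    apply: continuous_sum_fun => k; apply: continuousM; first exact: C1on_cont (@fC c k) cx.
    exact: C1on_pd (@chiC i c) cx.
  apply: continuousN; apply: continuousM; first exact: C1on_cont (@chiC i c) cx.
  exact: dotcWV_cont.
have intE i : (\int[omega]_(m in [set: borel M]) (E i m)%:E = 0)%E.
  pose c := chart_at A i; have [cKi Kc] := cK i.
  apply: (@chart_divergence _ _ _ _ g omega omega_vol lam lamE c (K i)
    (fun k x => vol g c x * (chi i (param c x) * fluxP c k x)) (E i)) => //.
  - move=> k; have oc := @cimg_open _ _ _ _ c.
    apply: (C1onM oc (@vol_C1 _ _ _ _ g c)); exact: (C1onM oc (@chiC i c) (@fC c k)).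
  - move=> k x cx; rewrite !mulf_eq0 !negb_or => /and3P[_ cn0 _].
    by have [_] := chiK i _ cn0; rewrite paramK.
  - move=> m; have [cm|ncm /eqP En0] := pselect (cdom c m); first by [].
    exfalso; apply: En0.
    have chi0 : chi i m = 0 by have [//|/chiK[]] := eqVneq (chi i m) 0.
    rewrite /E chi0 mul0r oppr0 add0r.
    set d := chart_at A m; have dm : cdom d m by exact: cdom_chart_at.
    (* That chi_i vanishes at [m] does not control its derivatives; but [m] lies in the open
       complement of [B], where chi_i is identically zero. *)
    pose B := param c @` K i.
    pose U2 := cimg d `&` param d @^-1` (~` B).
    have oU2 : open U2.
      apply: open_preimage_on; first exact: cimg_open.
        by move=> y dy; exact: continuous_param.
      by apply: closed_openC; exact: param_image_closed.
    have xU2 : U2 (coord d m).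
      split; first exact: cimg_coord.
      rewrite /= coordK// => -[y Ky ym]; apply: ncm; rewrite -ym; apply: cdom_param.
      exact: Kc.
    rewrite /Wc big1// => k _; rewrite (C1on_pd_eq0 k oU2 xU2) ?mulr0//.
    move=> y [dy yB]; have [//|/chiK[cy Ky]] := eqVneq (chi i (param d y)) 0.
    by exfalso; apply: yB; exists (coord c (param d y)) => //; exact: coordK.
  - move=> x cx; rewrite (EE i c x cx).
    rewrite (@pd_weighted_flux _ _ _ _ g mu U V (fun y => P (param c y))
      (fun y => chi i (param c y)) c x)//; last exact: chiC.
    by rewrite [X in _ = _ * (_ * X + _)]flux_div_force// mulrN.
have sumE m : \sum_(i <- s) E i m = - gdot g W V m.
  rewrite big_split/= sumrN -mulr_suml chi1 mul1r.
  set d := chart_at A m; have dm : cdom d m by exact: cdom_chart_at.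
  have dx := cimg_coord dm.
  (* The sum of the F(chi_i) is F applied to the constant function 1. *)
  rewrite [X in _ + X](_ : _ = 0) ?addr0// /Wc exchange_big/= big1// => k _.
  rewrite -mulr_sumr -pd_sum; last by move=> i; exact: C1on_diff (@chiC i d) dx.
  by rewrite (_ : (fun y => _) = (fun=> 1)) ?pd_cst ?mulr0//; apply/funext => y.
have ofin := @riemannian_volume_finite _ _ _ M_hausdorff M_compact _ g omega omega_vol lam lamE.
have Eint i : omega.-integrable setT (fun m : borel M => (E i m)%:E).
  exact: integrable_continuous.
transitivity (\int[omega]_(m in [set: borel M]) ((-1)%:E * \sum_(i <- s) (E i m)%:E))%E.
  by apply: eq_integral => m _; rewrite sumEFin sumE -EFinM mulN1r opprK.
rewrite integralZl//; last exact: integrable_sum.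
by rewrite integral_sum// big1 ?mule0.
Qed.

End divergence_form.
End conservation.

(** * From joint smoothness in time and space to smoothness at a fixed time *)

Section time_slices.
Variables (R : realType) (n : nat) (J : set R) (U : set 'rV[R]_n).
Variable f : R * 'rV[R]_n -> R.

(** The difference quotients coincide, a slice derivative being a derivative in direction [(0, v)];
    joint smoothness covers it because it quantifies over all directions. *)
Lemma derive_slice (h : R * 'rV[R]_n -> R) t x v :
  'D_v (fun y => h (t, y)) x = 'D_((0, v) : R * 'rV[R]_n) h (t, x) /\
  (derivable h (t, x) ((0, v) : R * 'rV[R]_n) -> derivable (fun y => h (t, y)) x v).
Proof.
have E : (fun r : R => r^-1 *: (((fun y => h (t, y)) \o shift x) (r *: v) - h (t, x))) =
   (fun r : R => r^-1 *: ((h \o shift (t, x)) (r *: ((0, v) : R * 'rV[R]_n)) - h (t, x))).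
  apply/funext => r /=; congr (_ *: (h _ - _)).
  by rewrite -[RHS]/(r *: 0 + t, r *: v + x) scaler0 add0r.
by rewrite /derive /derivable E.
Qed.

Lemma derive_time (h : R * 'rV[R]_n -> R) t x :
  'D_1 (fun s => h (s, x)) t = 'D_((1, 0) : R * 'rV[R]_n) h (t, x) /\
  (derivable h (t, x) ((1, 0) : R * 'rV[R]_n) -> derivable (fun s => h (s, x)) t 1).
Proof.
have E : (fun r : R => r^-1 *: (((fun s => h (s, x)) \o shift t) (r *: 1) - h (t, x))) =
   (fun r : R => r^-1 *: ((h \o shift (t, x)) (r *: ((1, 0) : R * 'rV[R]_n)) - h (t, x))).
  apply/funext => r /=; congr (_ *: (h _ - _)).
  by rewrite -[RHS]/(r *: 1 + t, r *: 0 + x) scaler0 add0r.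
by rewrite /derive /derivable E.
Qed.

Lemma smooth_slice t : J t -> smooth_on [set z : R * 'rV[R]_n | J z.1 /\ U z.2] f ->
  smooth_on U (fun x => f (t, x)).
Proof.
move=> Jt fS s x Ux.
have E : iter_derive s (fun y => f (t, y)) =
    (fun y => iter_derive [seq ((0, v) : R * 'rV[R]_n) | v <- s] f (t, y)).
  elim: s => //= v s ->; apply/funext => y.
  exact: (derive_slice _ t y v).1.
rewrite E; have [fc fd] := fS [seq ((0, v) : R * 'rV[R]_n) | v <- s] (t, x) (conj Jt Ux).
split; last by move=> v; apply: (derive_slice _ t x v).2; exact: fd.
apply: (@continuous_comp _ _ _ (fun y => (t, y))) => //.
by apply: (@cvg_pair _ _ _ (nbhs x) (nbhs t) (nbhs x) _ _ _ (fun=> t) id); [exact: cvg_cst|exact: cvg_id].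
Qed.

End time_slices.

(** * Differentiation in time *)

Section time_derivative.
Variables (R : realType) (n : nat) (M : ptopologicalType).
Variables (A : smooth_atlas R n M) (g : riemannian_metric A).
Variables (J : set R) (u : R -> components A) (v : components A).
Hypothesis J_open : open J.
Hypothesis u_smooth : smooth_time_vector_field J u.
Hypothesis v_smooth : smooth_vector_field v.

Definition dtime (s : R) : components A :=
  fun c x => \row_k 'D_1 (fun r => u r c x 0 k) s.

Let field c k (z : R * 'rV[R]_n) := u z.1 c z.2 0 k.

Lemma dtime_field c k s x : dtime s c x 0 k = iter_derive [:: ((1, 0) : R * 'rV[R]_n)] (field c k) (s, x).
Proof. by rewrite mxE; exact: (derive_time (field c k) s x).1. Qed.

Lemma field_derivable c k s x : J s -> cimg c x -> derivable (fun r => u r c x 0 k) s 1.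
Proof.
move=> Js cx; apply: (derive_time (field c k) s x).2.
by have [_] := u_smooth.2 c k [::] (s, x) (conj Js cx); apply.
Qed.

Lemma field_is_derive c k s x : J s -> cimg c x ->
  is_derive s 1 (fun r => u r c x 0 k) (dtime s c x 0 k).
Proof. by move=> Js cx; rewrite mxE; apply: DeriveDef; [exact: field_derivable|]. Qed.

Lemma dtime_continuous c k s x : J s -> cimg c x ->
  {for (s, x), continuous (fun z : R * 'rV[R]_n => dtime z.1 c z.2 0 k)}.
Proof.
move=> Js cx; rewrite (_ : (fun z => _) = iter_derive [:: ((1, 0) : R * 'rV[R]_n)] (field c k)).
  exact: (u_smooth.2 c k [:: ((1, 0) : R * 'rV[R]_n)] (s, x) (conj Js cx)).1.
by apply/funext => -[r y]; exact: dtime_field.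
Qed.

Lemma is_derive_combination (h : 'I_n -> R -> R) (a dh : 'I_n -> R) (s : R) :
  (forall i, is_derive s 1 (h i) (dh i)) ->
  is_derive s 1 (fun r => \sum_i a i * h i r) (\sum_i a i * dh i).
Proof.
move=> hd; rewrite (_ : (fun r => _) = \sum_i (a i *: h i)).
  by apply: is_derive_sum => i; exact: is_deriveZ.
by apply/funext => r; rewrite fct_sumE.
Qed.

(** The Jacobians do not depend on time, so the transformation law of [u], valid at all times near
    [s], can be differentiated. *)
Lemma dtime_contravariant s : J s -> contravariant (dtime s).
Proof.
move=> Js c d m cm dm k; rewrite mxE.
have cx := cimg_coord cm.
have E : \near s, u s d (coord d m) 0 k =
    \sum_(i < n) jac c d k i (coord c m) * u s c (coord c m) 0 i.
  near=> r; apply: u_smooth.1 => //; near: r; exact: open_nbhs_nbhs.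
rewrite (near_eq_derive _ E).
have := is_derive_combination (fun i => jac c d k i (coord c m)) (fun i => field_is_derive i Js cx).
by case.
Unshelve. all: by end_near. Qed.

Lemma gdot_is_derive s m : J s ->
  is_derive s 1 (fun r => gdot g (u r) v m) (gdot g (dtime s) v m).
Proof.
move=> Js; have cx := cimg_coord (cdom_chart_at A m).
set c := chart_at A m in cx; rewrite gdotE -/c.
rewrite (_ : (fun r => _) = fun r => \sum_k lower g v c k (coord c m) * u r c (coord c m) 0 k); last first.
  by apply/funext => r; rewrite gdotE; apply: eq_bigr => k _; exact: mulrC.
rewrite (_ : dotc _ _ _ _ _ = \sum_k lower g v c k (coord c m) * dtime s c (coord c m) 0 k); last first.
  by apply: eq_bigr => k _; exact: mulrC.
exact: is_derive_combination (fun k => field_is_derive k Js cx).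
Qed.

Let vC c : C1comp c v.
Proof. by move=> k; apply: smooth_C1on; [exact: cimg_open|exact: v_smooth.2]. Qed.

(** [gdot] uses the preferred chart of a varying point, which may jump; near [m] it is replaced by
    one fixed chart. Joint continuity is what bounds the time derivative uniformly below. *)
Lemma gdot_dtime_continuous s m : J s ->
  {for (s, m), continuous (fun z : R * M => gdot g (dtime z.1) v z.2)}.
Proof.
move=> Js; pose c := chart_at A m; have cm : cdom c m by exact: cdom_chart_at.
have cx := cimg_coord cm.
pose F (z : R * M) := \sum_k dtime z.1 c (coord c z.2) 0 k * lower g v c k (coord c z.2).
have coordc : {for (s, m), continuous (fun z : R * M => coord c z.2)}.
  by apply: continuous_comp; [exact: cvg_snd|exact: continuous_coord].
apply: (@near_eq_continuous _ _ F).
  near=> z; have [Jz cz] : J z.1 /\ cdom c z.2.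
    near: z; exists (J, cdom c) => [|//]; split => /=.
      exact: open_nbhs_nbhs.
    by apply: open_nbhs_nbhs; split; [exact: open_cdom|].
  by rewrite (gdot_chart g (dtime_contravariant Jz) v_smooth.1 cz).
apply: continuous_sum_fun => k; apply: continuousM.
  apply: (@continuous_comp _ _ _ (fun z : R * M => (z.1, coord c z.2))
    (fun z : R * 'rV[R]_n => dtime z.1 c z.2 0 k)); last exact: dtime_continuous.
  by apply: (@cvg_pair _ _ _ (nbhs (s, m)) (nbhs s) (nbhs (coord c m)) _ _ _
    fst (fun z => coord c z.2)); [exact: cvg_fst|exact: coordc].
apply: (@continuous_comp _ _ _ (fun z : R * M => coord c z.2) (lower g v c k)); first exact: coordc.
have lC : C1on (cimg c) (lower g v c k) by move=> y cy; apply: (lower_C1 g k (@vC c) cy).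
exact: C1on_cont lC cx.
Unshelve. all: by end_near. Qed.

Lemma field_slice_smooth s c k : J s -> smooth_on (cimg c) (fun x => u s c x 0 k).
Proof. by move=> Js; exact: (smooth_slice (f := field c k) Js (u_smooth.2 c k)). Qed.

Lemma gdot_continuous s : J s -> continuous (gdot g (u s) v).
Proof.
move=> Js; apply: (chart_continuous (fc := fun c x => dotc g (u s) v c x)) => c x cx.
split; first by rewrite (gdot_chart g (u_smooth.1 _ Js) v_smooth.1 (cdom_param cx)) paramK.
have uC : C1comp c (u s).
  by move=> k; apply: smooth_C1on; [exact: cimg_open|exact: field_slice_smooth].
have dC : C1on (cimg c) (dotc g (u s) v c) by move=> y cy; apply: (dotc_C1 g uC (@vC c) cy).
exact: C1on_cont dC cx.
Qed.

End time_derivative.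

Theorem theorem4p1 (R : realType) (n : nat) (M : ptopologicalType)
    (M_hausdorff : hausdorff_space M) (M_compact : compact [set: M])
    (A : smooth_atlas R n M) (g : riemannian_metric A)
    (omega : {measure set (borel M) -> \bar R})
    (omega_vol : is_riemannian_volume g omega)
    (mu : R) (J : set R) (J_open : open J) (J_itv : is_interval J)
    (u : R -> components A) (p : R -> M -> R) (v : components A)
    (u_smooth : smooth_time_vector_field J u)
    (p_smooth : smooth_time_function A J p)
    (NS : navier_stokes g mu J u p)
    (v_smooth : smooth_vector_field v) (v_killing : killing g v) :
  forall t : R, J t -> is_derive t 1 (fun s : R => inner g omega (u s) v) 0.
Proof.
move=> t Jt.
have [lam lamE] := lebesgue_int_measure R n.
have ofin := riemannian_volume_finite M_hausdorff M_compact omega_vol lamE.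
have vC c : C1comp c v.
  by move=> k; apply: smooth_C1on; [exact: cimg_open|exact: v_smooth.2].
have force0 := force_integral_eq0 M_hausdorff M_compact omega_vol
  (W := dtime u t) (U := u t) (V := v) (P := p t) (mu := mu).
have {}force0 : (\int[omega]_(m in [set: borel M]) (gdot g (dtime u t) v m)%:E = 0)%E.
  apply: force0 => //.
  - exact: (dtime_contravariant J_open u_smooth Jt).
  - exact: (u_smooth.1 _ Jt).
  - exact: v_smooth.1.
  - move=> c k x cx.
    apply: (@continuous_comp _ _ _ (fun y : 'rV[R]_n => (t, y))
      (fun z : R * 'rV[R]_n => dtime u z.1 c z.2 0 k)); last exact: (dtime_continuous u_smooth).
    by apply: (@cvg_pair _ _ _ (nbhs x) (nbhs t) (nbhs x) _ _ _ (fun=> t) id); [exact: cvg_cst|exact: cvg_id].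
  - by move=> c k; apply: smooth_C2on; [exact: cimg_open|exact: (field_slice_smooth u_smooth)].
  - move=> c; apply: smooth_C1on; first exact: cimg_open.
    exact: (smooth_slice (f := fun z => p z.1 (param c z.2)) Jt (p_smooth c)).
  - by move=> c x cx; have [ns d0] := NS t Jt c x cx; split => // k; rewrite mxE; exact: ns.
(* A closed interval, so that its product with M is compact. *)
have [e e0 eJ] : exists2 e : R, 0 < e & `[t - e, t + e] `<=` J.
  have /nbhs_ballP[d /= d0 dJ] : nbhs t J by exact: open_nbhs_nbhs.
  exists (d / 2); first by rewrite divr_gt0.
  move=> s /=; rewrite in_itv/= => /andP[s1 s2]; apply: dJ; rewrite /ball/= ltr_norml.
  by apply/andP; split; lra.
(* The constant [C] dominates the time derivative for all times near [t], and it is integrable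
   because the volume is finite. *)
have [C C0 HC] := compact_bounded_fun (f := fun z : R * M => gdot g (dtime u z.1) v z.2)
  (compact_setX (@segment_compact R (t - e) (t + e)) M_compact)
  (fun z zK => gdot_dtime_continuous J_open u_smooth v_smooth (eJ _ zK.1)).
have tI : `]t - e, t + e[%classic t by rewrite /= in_itv/=; apply/andP; split; lra.
have IJ s : `]t - e, t + e[%classic s -> `[t - e, t + e]%classic s by exact: subset_itv_oo_cc.
have intf s : `]t - e, t + e[%classic s ->
    omega.-integrable setT (EFin \o ((fun r m => gdot g (u r) v m) s : borel M -> R)).
  move=> /IJ/eJ Js; apply: integrable_continuous => //; exact: gdot_continuous Js.
have dE s (m : borel M) : `]t - e, t + e[%classic s -> setT m ->
    is_derive s 1 (fun r => gdot g (u r) v m) (gdot g (dtime u s) v m).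
  by move=> /IJ/eJ Js _; exact: (gdot_is_derive g v u_smooth m Js).
have derf s (m : borel M) : `]t - e, t + e[%classic s -> setT m ->
    derivable (fun r => gdot g (u r) v m) s 1 by move=> sI mT; case: (dE s m sI mT).
have intC : omega.-integrable setT (EFin \o (fun _ : borel M => C)).
  by apply: integrable_continuous => //; exact: cst_continuous.
have bnd s (m : borel M) : `]t - e, t + e[%classic s -> setT m ->
    `|partial1of2 (fun r m => gdot g (u r) v m) s m| <= C.
  move=> sI mT; rewrite partial1of2E; have [_ ->] := dE s m sI mT.
  by apply: (HC (s, m)); split => //=; exact: IJ.
have der := derivable_under_integral measurableT tI intf derf (fun=> C0) intC bnd.
split; first exact: der.
rewrite -derive1E (differentiation_under_integral measurableT tI intf derf (fun=> C0) intC bnd).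
transitivity (\int[omega]_(m in [set: borel M]) gdot g (dtime u t) v m)%R.
  by apply: eq_Rintegral => m _; rewrite partial1of2E; have [_ ->] := dE t m tI I.
by rewrite /Rintegral force0.
Qed.
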